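(* Let $\{X_i\}$ be i.i.d. with arbitrary law $\mu$. Then $\mathcal X_M=\overline{\mathcal X_B}\cap\{f:f(0)=1\}$ (closure in $(\mathcal X_M',\tau_{AW})$), and $\{M_n\}$ satisfies the large deviation principle in $(\mathcal X_M,\tau_{AW})$ with good rate function $$I_M(f)=-\inf_{G\ni f}\limsup_{n\to\infty}\frac1n\log P(M_n\in G)=-\inf_{G\ni f}\liminf_{n\to\infty}\frac1n\log P(M_n\in G),$$ the infima being over $\tau_{AW}$-open $G$ containing $f$.
   Context: Let $\{X_i\}_{i\ge1}$ be i.i.d. real-valued random variables with common law $\mu$, $M_n(\theta)=\frac1n\sum_{i=1}^ne^{\theta X_i}$. For a probability measure $\nu$ let $f_\nu(\theta)=\int e^{\theta x}\nu(dx)\in(0,\infty]$. $\mathcal X_B=\{f_\nu:\nu$ compactly supported probability on $\mathbb R\}$. For $f:\mathbb R\to[-\infty,\infty]$, $\mathrm{epi}(f)=\{(\theta,b):b\ge f(\theta)\}$. On $\mathbb R^2$ use the box metric $d$, $d(x,A)=\inf_{y\in A}d(x,y)$, $\overline B_k=\{x:d(0,x)\le k\}$. The Attouch–Wets topology $\tau_{AW}$ has local base at $f$ given by $V_k(f)=\{g:\sup_{x\in\overline B_k}|d(x,\mathrm{epi}(g))-d(x,\mathrm{epi}(f))|<1/k\}$. $\mathcal X_M'$ = lower semicontinuous convex $f:\mathbb R\to[0,\infty]$ with $f(0)<\infty$; $\mathcal X_M$ = those $f\in\mathcal X_M'$ with values in $(0,\infty]$ for which some probability $\nu$ satisfies $f(\theta)=f_\nu(\theta)$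 whenever $f(\theta)<\infty$. A good rate function is lower semicontinuous with compact level sets. *)

(* Defs.v *)
From mathcomp Require Import all_boot all_order all_algebra.
From mathcomp Require Import all_classical all_reals all_analysis.
Set Implicit Arguments. Unset Strict Implicit. Unset Printing Implicit Defensive.
Import Order.TTheory GRing.Theory Num.Theory numFieldNormedType.Exports.
Local Open Scope classical_set_scope.
Local Open Scope ring_scope.

Section Defs.
Variable R : realType.

Definition efun := R -> \bar R.

Definition mgf (nu : probability R R) : efun :=
  fun t => (\int[nu]_x (expR (t * x))%:E)%E.

Definition XB : set efun :=
  [set f | exists (nu : probability R R) (c : R),
      nu `[- c, c]%classic = 1%E /\ f = mgf nu].

Definition epi (f : efun) : set (R * R) :=
  [set p | (f p.1 <= (p.2)%:E)%E].

Definition boxd (x y : R * R) : R := Num.max `|x.1 - y.1| `|x.2 - y.2|.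

(* distance from a point to a set (inf over the empty set is +oo) *)
Definition dist (x : R * R) (A : set (R * R)) : \bar R :=
  ereal_inf [set (boxd x y)%:E | y in A].

Definition Bk (k : nat) : set (R * R) := [set x | boxd 0 x <= k%:R].

Definition Vk (k : nat) (f : efun) : set efun :=
  [set g | (ereal_sup [set `| dist x (epi g) - dist x (epi f) |%E | x in Bk k]
             < (k%:R^-1)%:E)%E].

Definition econvex (f : efun) : Prop :=
  forall (x y t : R), 0 <= t <= 1 ->
    (f (t * x + (1 - t) * y)%R <= t%:E * f x + (1 - t)%:E * f y)%E.

Definition elsc (f : efun) : Prop :=
  forall x (a : \bar R), (a < f x)%E -> \forall y \near x, (a < f y)%E.

Definition XMp : set efun :=
  [set f | elsc f /\ econvex f /\ (forall t, (0 <= f t)%E) /\ (f 0%R < +oo)%E].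

Definition XM : set efun :=
  [set f | XMp f /\ (forall t, (0 < f t)%E) /\
    exists nu : probability R R, forall t, (f t < +oo)%E -> f t = mgf nu t].

(* Attouch-Wets topology relative to a subspace S of X_M':
   G is open in S iff G is contained in S and each f in G has some V_k(f),
   k >= 1, whose trace on S lies in G *)
Definition AWopen (S : set efun) (G : set efun) : Prop :=
  G `<=` S /\ forall f, G f -> exists k, (0 < k)%N /\ Vk k f `&` S `<=` G.

Definition AWclosed (S : set efun) (F : set efun) : Prop :=
  F `<=` S /\ AWopen S (S `\` F).

Definition AWclosure (A : set efun) : set efun :=
  [set f | XMp f /\ forall k, (0 < k)%N -> exists g, (Vk k f `&` XMp `&` A) g].

Definition AWcompact (S : set efun) (K : set efun) : Prop :=
  K `<=` S /\
  forall (I : Type) (U : I -> set efun), (forall i, AWopen S (U i)) ->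
    K `<=` \bigcup_i U i -> exists J : set I, finite_set J /\ K `<=` \bigcup_(i in J) U i.

Definition elog (x : R) : \bar R := if x == 0 then -oo%E else (ln x)%:E.

End Defs.

Arguments XM R : clear implicits.
Arguments XB R : clear implicits.
Arguments XMp R : clear implicits.

Section Prob.
Variables (R : realType) (d : measure_display) (T : measurableType d)
  (P : probability T R).

Definition iid_seq (mu : probability R R) (X : nat -> T -> R) : Prop :=
  (forall i, measurable_fun setT (X i)) /\
  (forall i (B : set R), measurable B -> P (X i @^-1` B) = mu B) /\
  (forall (s : seq nat) (B : nat -> set R), uniq s ->
     (forall i, measurable (B i)) ->
     P (\bigcap_(i in [set` s]) (X i @^-1` B i)) =
       (\prod_(i <- s) P (X i @^-1` B i))%E).

Definition Mn (X : nat -> T -> R) (n : nat) (w : T) : efun R :=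
  fun t => ((n%:R)^-1 * \sum_(i < n) expR (t * X i w))%:E.

Definition lprob (X : nat -> T -> R) (G : set (efun R)) (n : nat) : \bar R :=
  ((n%:R)^-1)%:E * elog (fine (P [set w | G (Mn X n w)])).

Definition IM (X : nat -> T -> R) (f : efun R) : \bar R :=
  - ereal_inf [set limn_esup (lprob X G) | G in [set G | AWopen (XM R) G /\ G f]].

Definition IM_liminf (X : nat -> T -> R) (f : efun R) : \bar R :=
  - ereal_inf [set limn_einf (lprob X G) | G in [set G | AWopen (XM R) G /\ G f]].

Definition good_rate (I : efun R -> \bar R) : Prop :=
  (forall f, XM R f -> (0 <= I f)%E) /\
  (forall a : R, AWclosed (XM R) [set f | XM R f /\ (I f <= a%:E)%E]) /\
  (forall a : R, AWcompact (XM R) [set f | XM R f /\ (I f <= a%:E)%E]).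

Definition LDP (X : nat -> T -> R) (I : efun R -> \bar R) : Prop :=
  (forall G, AWopen (XM R) G ->
     - ereal_inf (I @` G) <= limn_einf (lprob X G))%E /\
  (forall F, AWclosed (XM R) F ->
     limn_esup (lprob X F) <= - ereal_inf (I @` F))%E.

End Prob.

(* Main.v *)
Require Import Defs.
From HB Require Import structures.
From mathcomp Require Import all_boot all_order all_algebra.
From mathcomp Require Import all_classical all_reals all_analysis.
From mathcomp Require Import measurable_realfun.
From mathcomp Require Import ring lra.
Set Implicit Arguments. Unset Strict Implicit. Unset Printing Implicit Defensive.
Import Order.TTheory GRing.Theory Num.Theory numFieldNormedType.Exports.
Local Open Scope classical_set_scope.
Local Open Scope ring_scope.

(* The lower semicontinuous convex functions with f(0) <= 1 form a compact space for the
   Attouch-Wets topology, and XM sits in it as a subset that is not closed. If transforms converge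
   to f along an ultrafilter and f(0) = 1, their laws have a limit whose transform agrees with f
   where f is finite; conversely, an atom of mass e^{-bn}/n at n cuts off a transform at b without
   changing the limit law.
   Averaging M_N over independent blocks makes the law of M_n near f superadditive up to a bounded
   remainder, so that the upper and lower rates coincide. The missing compactness of XM is repaired
   by the fact that near f with f(0) < 1 a positive fraction of the |X_i| must be arbitrarily large,
   an event whose probability decays at every exponential rate. *)

(** Nearness to [f] gives no pointwise control at an endpoint of the effective domain, where a
    nearby convex function may be infinite. It is therefore handled through hits (a small value at
    some point close to t) and misses (large values on a whole segment). Inside the domain,
    convexity turns two hits on either side of t into an upper bound at t itself; endpoints are then
    reached from inside, by lower semicontinuity and convexity, or by moving t slightly towards 0.
    Compactness of [XMp1] enters in the form: an ideal of sets that contains a neighbourhood of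
    every point contains the whole space. Applied to the sets whose trace on a level set is finitely
    coverable it gives goodness; applied to the exponentially small sets it gives the upper bound
    for closed sets. A point outside [XM] with f(0) = 1 never interferes: the description of the
    closure separates it from all of [XB], where every [Mn] with n > 0 lives. *)

Section AttouchWets.
Variable R : realType.
Implicit Types (f g : efun R) (x y : R * R).

Lemma boxd_ge0 x y : 0 <= boxd x y.
Proof. by rewrite le_max normr_ge0. Qed.

Lemma boxdxx x : boxd x x = 0.
Proof. by rewrite /boxd !subrr normr0 maxxx. Qed.

Lemma boxdC x y : boxd x y = boxd y x.
Proof. by rewrite /boxd distrC (distrC x.2). Qed.

Lemma boxd_triangle y x z : boxd x z <= boxd x y + boxd y z.
Proof.
rewrite /boxd ge_max; apply/andP; split.
  by rewrite (le_trans (ler_distD y.1 _ _))// lerD// le_max lexx.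
by rewrite (le_trans (ler_distD y.2 _ _))// lerD// le_max lexx orbT.
Qed.

Definition rdist f x : R := inf [set boxd x y | y in epi f].

Lemma XMp_fin f t : XMp R f -> (f t < +oo)%E -> exists2 r, f t = r%:E & 0 <= r.
Proof.
move=> [_ [_ [f0 _]]] ft; exists (fine (f t)); last exact: fine_ge0.
by rewrite fineK// ge0_fin_numE.
Qed.

Lemma XMp_epi f : XMp R f -> epi f !=set0.
Proof.
move=> fX; have [_ [_ [_ f0]]] := fX.
by have [r fr _] := XMp_fin fX f0; exists (0, r); rewrite /epi /= fr.
Qed.

Lemma rdist_has_inf f x : epi f !=set0 -> has_inf [set boxd x y | y in epi f].
Proof.
move=> [y fy]; split; first by exists (boxd x y), y.
by exists 0 => _ [z _ <-]; exact: boxd_ge0.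
Qed.

Lemma dist_rdist f x : epi f !=set0 -> dist x (epi f) = (rdist f x)%:E.
Proof.
move=> f0; rewrite /dist /rdist.
have [h1 h2] := rdist_has_inf x f0.
by rewrite -(ereal_inf_EFin h2 h1) image_comp.
Qed.

Lemma rdist_ge0 f x : epi f !=set0 -> 0 <= rdist f x.
Proof.
move=> f0; apply: lb_le_inf; first by have [] := rdist_has_inf x f0.
by move=> _ [z _ <-]; exact: boxd_ge0.
Qed.

Lemma rdist_le f x y : epi f y -> rdist f x <= boxd x y.
Proof.
move=> fy; apply: ge_inf; last by exists y.
by have [] := @rdist_has_inf f x (ex_intro _ _ fy).
Qed.

Lemma rdist_lt f x r : epi f !=set0 -> rdist f x < r ->
  exists2 y, epi f y & boxd x y < r.
Proof.
move=> f0 xr; have [] := @inf_lt _ [set boxd x y | y in epi f] r.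
- by have [] := rdist_has_inf x f0.
- by [].
- by move=> _ [y fy <-] yr; exists y.
Qed.

Lemma rdist_lip f x y : epi f !=set0 -> rdist f x <= rdist f y + boxd x y.
Proof.
move=> f0; apply/ler_addgt0Pr => e e0.
have [z fz zr] := @rdist_lt f y (rdist f y + e) f0 (ltac:(by rewrite ltrDl)).
by rewrite (le_trans (rdist_le x fz))// (le_trans (boxd_triangle y _ _))//; lra.
Qed.

(** The supremum in [Vk] is strictly below 1 / k, so a single e < 1 / k bounds all differences. The
    gap between e and 1 / k is what makes [Vk k f] open in [Vk_open]. *)
Lemma VkP k f g : XMp R f -> XMp R g ->
  Vk k f g <-> exists2 e, e < k%:R^-1 &
    forall x, Bk k x -> `|rdist g x - rdist f x| <= e.
Proof.
move=> /XMp_epi f0 /XMp_epi g0; split.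
- rewrite /Vk /=; set S := [set _ | _ in _] => /= h.
  have S0 : S `|rdist g 0 - rdist f 0|%:E.
    exists 0; first by rewrite /Bk /= boxdxx.
    by rewrite !dist_rdist//.
  have Sl : (0 <= ereal_sup S)%E.
    by apply: le_trans (ereal_sup_ubound S0); rewrite lee_fin.
  have Sfin : ereal_sup S \is a fin_num.
    by rewrite ge0_fin_numE// (lt_trans h)// ltry.
  exists (fine (ereal_sup S)); first by rewrite -lte_fin fineK.
  move=> x Bx; rewrite -lee_fin fineK//; apply: ereal_sup_ubound.
  by exists x => //; rewrite !dist_rdist.
- move=> [e ek h]; rewrite /Vk /=; apply: (@le_lt_trans _ _ e%:E) => //.
  apply: ge_ereal_sup => _ [x Bx <-]; rewrite !dist_rdist//.
  by rewrite lee_fin h.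
Qed.

Lemma Vk_self k f : (0 < k)%N -> XMp R f -> Vk k f f.
Proof.
move=> k0 fX; apply/VkP => //; exists 0; first by rewrite invr_gt0 ltr0n.
by move=> x _; rewrite subrr normr0.
Qed.

Lemma Vk_le k l f g : (0 < k)%N -> (k <= l)%N -> XMp R f -> XMp R g ->
  Vk l f g -> Vk k f g.
Proof.
move=> k0 kl fX gX /VkP -/(_ fX gX)[e el h]; apply/VkP => //; exists e.
  rewrite (lt_le_trans el)// lef_pV2 ?posrE ?ltr0n ?ler_nat//.
  exact: leq_trans kl.
by move=> x Bx; apply: h; rewrite /Bk /= (le_trans Bx)// ler_nat.
Qed.

Lemma archi_inv (e : R) : 0 < e -> exists k, (0 < k)%N /\ k%:R^-1 < e.
Proof.
move=> e0; exists (Num.truncn e^-1).+1; split => //.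
by rewrite invf_plt ?posrE// truncnS_gt.
Qed.

Lemma Vk_open k f g : (0 < k)%N -> XMp R f -> XMp R g -> Vk k f g ->
  exists2 l, (0 < l)%N & forall h, XMp R h -> Vk l g h -> Vk k f h.
Proof.
move=> k0 fX gX /VkP -/(_ fX gX)[e ek fg].
have [m [m0 me]] := @archi_inv (k%:R^-1 - e) (ltac:(lra)).
exists (maxn k m) => [|h hX]; first by rewrite leq_max k0.
have mk : (k <= maxn k m)%N by rewrite leq_maxl.
have mm : (m <= maxn k m)%N by rewrite leq_maxr.
move=> hV; have /VkP -/(_ gX hX)[e1 e1m gh] := Vk_le m0 mm gX hX hV.
have /VkP -/(_ gX hX)[e2 e2k gh2] := hV.
apply/VkP => //; exists (e + e2).
  suff : e2 < m%:R^-1 by lra.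
  apply: (lt_le_trans e2k); rewrite lef_pV2 ?posrE ?ltr0n ?ler_nat//.
  by rewrite leq_max m0 orbT.
move=> x Bx; have Bx' : Bk (maxn k m) x by rewrite /Bk /= (le_trans Bx)// ler_nat.
rewrite (le_trans (ler_distD (rdist g x) _ _))// addrC lerD ?fg ?gh2//.
Qed.

Lemma AWopen_Vk k f : (0 < k)%N -> XMp R f -> AWopen (XM R) (Vk k f `&` XM R).
Proof.
move=> k0 fX; split=> [g []//|g [gV [gX gM]]].
have [l l0 h] := Vk_open k0 fX gX gV.
by exists l; split => // u [uV uX]; split => //; apply: h => //; case: uX.
Qed.

(* The slack in both the level and the interval comes from compactness of [p, q]. *)
Lemma elsc_itv_slack f (p q d : R) : elsc f ->
  (forall t, p <= t <= q -> (d%:E < f t)%E) ->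
  exists2 e, 0 < e & forall t, p - e <= t <= q + e -> ((d + e)%:E < f t)%E.
Proof.
move=> fl fd.
have /compact_near_coveringP K := @segment_compact R p q.
pose P (e : R) (t : R) := forall s, `|s - t| <= e -> ((d + e)%:E < f s)%E.
have := K _ (0^'+) P _ _; case.
  move=> t /=; rewrite in_itv /= => /fd dft.
  have [d' [dd' d'ft]] : exists d', d < d' /\ (d'%:E < f t)%E.
    case: (f t) dft => [r| |]//=; last by exists (d + 1); rewrite ltry; split=>//; lra.
    rewrite lte_fin => dr; exists ((d + r) / 2); rewrite lte_fin; split; lra.
  have /nbhs_ballP[r /= r0 Br] := fl t _ d'ft.
  exists (ball t (r / 2), [set e | 0 < e /\ e < Num.min (r / 2) (d' - d)]).
    split; first by apply: nbhsx_ballx; lra.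
    near=> e; split => //; near: e; apply: nbhs_right_lt.
    by rewrite lt_min; apply/andP; split; lra.
  move=> [s e] /= [] /=; rewrite /ball /= => ts [e0].
  rewrite lt_min => /andP[er ed] u us.
  apply: (@le_lt_trans _ _ d'%:E); first by rewrite lee_fin; lra.
  apply: Br; rewrite /ball /=.
  rewrite (le_lt_trans (ler_distD s _ _))// -(distrC u); lra.
move=> e0 /= e0p h; pose e := e0 / 2.
have ep : 0 < e by rewrite /e divr_gt0.
have [pq|pq] := leP p q; last first.
  (* An empty segment must remain empty after widening by e on both sides, so e has to stay below (p
     - q) / 2. *)
  pose e1 := (p - q) / 4.
  exists e1 => [|t]; rewrite /e1; first lra.
  by move=> /andP[t1 t2]; exfalso; lra.
exists e => // t /andP[t1 t2].
have he := h e; move: he; rewrite /ball /= sub0r normrN gtr0_norm//.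
have -> : e < e0 by rewrite /e; lra.
move=> /(_ isT ep) he.
have [tp|tp] := leP t p.
  apply: (he p); first by rewrite /= in_itv /= lexx.
  by rewrite ler_norml; apply/andP; split; lra.
have [tq|tq] := leP t q.
  by apply: (he t); rewrite ?subrr ?normr0 ?(ltW ep)//= in_itv /= tq ltW.
apply: (he q); first by rewrite /= in_itv /= lexx pq.
by rewrite ler_norml; apply/andP; split; lra.
Unshelve. all: by end_near. Qed.

(** The point [(t, f t)] is on the epigraph of [f], so the epigraph of a close [g] comes within
    min(e, c - f t) of it. The abscissa may move: [g t] itself can be infinite. *)
Lemma Vk_hit f (t c e : R) : XMp R f -> (f t < c%:E)%E -> 0 < e ->
  exists2 k, (0 < k)%N & forall g, XMp R g -> Vk k f g ->
    exists2 s, `|s - t| < e & (g s < c%:E)%E.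
Proof.
move=> fX ftc e0; have [r fr r0] := XMp_fin fX (lt_trans ftc (ltry _)).
move: ftc; rewrite fr lte_fin => rc.
have e1 : 0 < Num.min e (c - r) by rewrite lt_min e0 subr_gt0.
have [k1 [k10 k1e]] := archi_inv e1.
pose k := maxn k1 (Num.truncn (boxd 0 (t, r))).+1.
have k0 : (0 < k)%N by rewrite /k leq_max k10.
exists k => // g gX /VkP -/(_ fX gX)[e2 e2k fg].
have Bk : Bk k (t, r).
  rewrite /Bk /=; apply: (@le_trans _ _ ((Num.truncn (boxd 0 (t, r))).+1%:R)).
    by rewrite ltW// truncnS_gt.
  by rewrite ler_nat /k leq_max leqnn orbT.
have := fg _ Bk.
have -> : rdist f (t, r) = 0.
  apply/eqP; rewrite eq_le rdist_ge0 ?andbT; last exact: XMp_epi.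
  by rewrite -(boxdxx (t, r)) rdist_le// /epi /= fr.
rewrite subr0 => gd.
have kk1 : k%:R^-1 <= k1%:R^-1 :> R.
  by rewrite lef_pV2 ?posrE ?ltr0n ?ler_nat// /k leq_max leqnn.
have [] := @rdist_lt g (t, r) (Num.min e (c - r)) (XMp_epi gX).
  by apply: (le_lt_trans (ler_norm _)); lra.
move=> y gy; rewrite /boxd gt_max !lt_min /= => /andP[/andP[y1 _] /andP[_ y2]].
exists y.1; first by rewrite distrC.
apply: (le_lt_trans gy); rewrite lte_fin.
by move: y2; rewrite ltr_norml => /andP[]; lra.
Qed.

(** If g(t) <= d, then [(t, d)] lies on the epigraph of [g], so the epigraph of [f] comes within e
    of it; this contradicts the slack of [elsc_itv_slack]. *)
Lemma Vk_miss f (p q d : R) : XMp R f ->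
  (forall t, p <= t <= q -> (d%:E < f t)%E) ->
  exists2 k, (0 < k)%N & forall g, XMp R g -> Vk k f g ->
    forall t, p <= t <= q -> (d%:E < g t)%E.
Proof.
move=> fX fd; have [fl _] := fX.
have [e e0 fe] := elsc_itv_slack fl fd.
have [k1 [k10 k1e]] := archi_inv e0.
pose b := Num.max (Num.max `|p| `|q|) `|d|.
pose k := maxn k1 (Num.truncn b).+1.
have k0 : (0 < k)%N by rewrite /k leq_max k10.
exists k => // g gX /VkP -/(_ fX gX)[e2 e2k fg] t tpq.
rewrite ltNge; apply/negP => gtd.
have Bk : Bk k (t, d).
  rewrite /Bk /=; apply: (@le_trans _ _ b).
    rewrite /boxd /= !sub0r !normrN /b ge_max !le_max lexx orbT andbT.
    move: tpq => /andP[pt tq].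
    have := ler_norm (-p); have := ler_norm q; rewrite normrN => h1 h2.
    have [t0|t0] := leP 0 t.
      by rewrite ger0_norm// (le_trans tq h1) orbT.
    by rewrite ltr0_norm// (_ : - t <= `|p|)//; lra.
  apply: (@le_trans _ _ ((Num.truncn b).+1%:R)); first by rewrite ltW// truncnS_gt.
  by rewrite ler_nat /k leq_max leqnn orbT.
have := fg _ Bk.
have -> : rdist g (t, d) = 0.
  apply/eqP; rewrite eq_le rdist_ge0 ?andbT; last exact: XMp_epi.
  by rewrite -(boxdxx (t, d)) rdist_le// /epi /=.
rewrite sub0r normrN => fr.
have kk1 : k%:R^-1 <= k1%:R^-1 :> R.
  by rewrite lef_pV2 ?posrE ?ltr0n ?ler_nat// /k leq_max leqnn.
have [] := @rdist_lt f (t, d) e (XMp_epi fX).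
  by apply: (le_lt_trans (ler_norm _)); lra.
move=> y fy; rewrite /boxd gt_max /= => /andP[].
rewrite !ltr_norml => /andP[y1 y2] /andP[y3 y4].
have := fe y.1; rewrite (_ : p - e <= y.1 <= q + e); last first.
  by move: tpq => /andP[? ?]; apply/andP; split; lra.
move=> /(_ isT); rewrite ltNge => /negP; apply.
by apply: (le_trans fy); rewrite lee_fin; lra.
Qed.

(* Hits of open half-strips and misses of compact segments determine the Attouch-Wets topology. *)
Lemma hit_miss_Vk (F : set_system (efun R)) f : Filter F -> F (XMp R) -> XMp R f ->
  (forall t c e : R, (f t < c%:E)%E -> 0 < e ->
     F [set g | exists2 s, `|s - t| < e & (g s < c%:E)%E]) ->
  (forall p q d : R, (forall t, p <= t <= q -> (d%:E < f t)%E) ->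
     F [set g | forall t, p <= t <= q -> (d%:E < g t)%E]) ->
  forall k, (0 < k)%N -> F (Vk k f).
Proof.
move=> FF FX fX hit miss k k0.
have f0 := XMp_epi fX.
(* Distances converge pointwise: a hit near an almost nearest point bounds [rdist g x] from above,
   and a miss of the box of radius [rdist f x - e] bounds it from below. *)
have pw x e : 0 < e -> F [set g | `|rdist g x - rdist f x| <= e].
  move=> e0.
  have up : F [set g | rdist g x <= rdist f x + e].
    have [y fy xy] := @rdist_lt f x (rdist f x + e / 2) f0 (ltac:(lra)).
    have fy2 : (f y.1 < (y.2 + e / 2)%:E)%E.
      by apply: (le_lt_trans fy); rewrite lte_fin; lra.
    have e2 : 0 < e / 2 by lra.
    apply: filterS (hit _ _ _ fy2 e2) => g [s sy gs].
    apply: (@le_trans _ _ (boxd x (s, y.2 + e / 2))).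
      by apply: rdist_le; rewrite /epi /= ltW.
    rewrite (le_trans (boxd_triangle y _ _))//.
    suff : boxd y (s, y.2 + e / 2) <= e / 2 by lra.
    rewrite /boxd /= ge_max distrC (ltW sy) opprD addrA subrr sub0r normrN.
    by rewrite ger0_norm//; lra.
  have dn : F [set g | rdist f x <= rdist g x + e].
    pose r := rdist f x - e.
    have [r0|r0] := ltP r 0.
      apply: filterS FX => g gX /=; have := @rdist_ge0 g x (XMp_epi gX).
      by rewrite /r in r0; lra.
    (* Epigraphs are closed upwards, so missing the box around x amounts to staying above its top
       edge. *)
    have fm : forall t, x.1 - r <= t <= x.1 + r -> ((x.2 + r)%:E < f t)%E.
      move=> t /andP[t1 t2]; rewrite ltNge; apply/negP => h.
      have := @rdist_le f x (t, x.2 + r) h.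
      rewrite /boxd /= opprD addrA subrr sub0r normrN (ger0_norm r0).
      have -> : Num.max `|x.1 - t| r = r.
        by apply/max_idPr; rewrite ler_norml; apply/andP; split; lra.
      by rewrite /r; lra.
    apply: filterS (filterI (miss _ _ _ fm) FX) => g [gm gX].
    rewrite /= leNgt; apply/negP => h.
    have [] := @rdist_lt g x r (XMp_epi gX); first by rewrite /r; lra.
    move=> y gy; rewrite /boxd gt_max !ltr_norml => /andP[/andP[y1 y2] /andP[y3 y4]].
    have := gm y.1; rewrite (_ : _ <= y.1 <= _); last by apply/andP; split; lra.
    move=> /(_ isT); rewrite ltNge => /negP; apply.
    by apply: (le_trans gy); rewrite lee_fin; lra.
  apply: filterS (filterI up dn) => g [/= h1 h2].
  by rewrite ler_norml; apply/andP; split; lra.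
have cB : compact (Bk k : set (R * R)).
  have -> : Bk k = `[- k%:R, k%:R]%classic `*` `[- k%:R, k%:R]%classic :> set (R * R).
    apply/seteqP; split=> -[a b]; rewrite /Bk /boxd /= !in_itv /= !sub0r !normrN.
      by rewrite ge_max !ler_norml => /andP[].
    by move=> [h1 h2]; rewrite ge_max !ler_norml h1.
  by apply: compact_setX; exact: segment_compact.
have /compact_near_coveringP K := cB.
(* Distance functions are 1-Lipschitz, so an error e at x becomes at most 3 e on the ball of radius
   e around x; compactness of [Bk k] then makes it uniform, and 3 / 8 < 1. *)
pose e := k%:R^-1 / 8 : R.
have e0 : 0 < e by rewrite /e divr_gt0// invr_gt0 ltr0n.
have Kn : F [set g | Bk k `<=` (fun x => `|rdist g x - rdist f x| <= 3 * e)].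
  apply: (K _ F (fun g x => `|rdist g x - rdist f x| <= 3 * e) FF) => x _.
  exists ([set y : R * R | boxd x y < e], [set g | `|rdist g x - rdist f x| <= e] `&` XMp R).
    split; last exact: filterI (pw x e e0) FX.
    apply/nbhs_ballP; exists e => //= y [] /=; rewrite /ball /= => y1 y2.
    by rewrite /boxd gt_max y1 y2.
  move=> [y g] /= [xy [gx gX]].
  have g0 := XMp_epi gX.
  have := rdist_lip y x g0; have := rdist_lip x y g0.
  have := rdist_lip y x f0; have := rdist_lip x y f0.
  rewrite (boxdC y x); move: gx; rewrite !ler_norml => /andP[? ?] ? ? ? ?.
  by apply/andP; split; lra.
apply: filterS (filterI Kn FX) => g [gK gX].
apply/VkP => //; exists (3 * e); last exact: gK.
rewrite /e; have : 0 < k%:R^-1 :> R by rewrite invr_gt0 ltr0n.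
by lra.
Qed.

End AttouchWets.

(** * Compactness of the space of functions with f(0) <= 1 *)

Section Compactness.
Variable R : realType.
Implicit Types (f g : efun R).

Lemma EFin_lt_slack (v : R) (a : \bar R) : (v%:E < a)%E ->
  exists2 e, 0 < e & ((v + e)%:E < a)%E.
Proof.
case: a => [r| |]//=; last by exists 1 => //; rewrite ltry.
by rewrite lte_fin => vr; exists ((r - v) / 2); rewrite ?lte_fin; lra.
Qed.

Lemma econvex_lt g (s1 s2 t c1 c2 : R) : XMp R g -> 0 <= t <= 1 ->
  (g s1 < c1%:E)%E -> (g s2 < c2%:E)%E ->
  (g (t * s1 + (1 - t) * s2)%R < (t * c1 + (1 - t) * c2)%:E)%E.
Proof.
move=> gX t01 h1 h2; have [_ [gc _]] := gX.
have [r1 g1 _] := XMp_fin gX (lt_trans h1 (ltry _)).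
have [r2 g2 _] := XMp_fin gX (lt_trans h2 (ltry _)).
apply: (le_lt_trans (gc _ _ _ t01)); move: h1 h2; rewrite g1 g2 -!EFinM -EFinD !lte_fin.
move: t01 => /andP[t0 t1] h1 h2.
have [t00|t00] := eqVneq t 0; first by rewrite t00; lra.
have tp : 0 < t by rewrite lt_def t00.
by rewrite ltr_leD// ?ltr_pM2l// ler_wpM2l ?subr_ge0// ltW.
Qed.

Definition XMp1 : set (efun R) := [set f | XMp R f /\ (f 0%R <= 1)%E].

(** The limit is the lower epi-limit: f(t) is the supremum of the d such that U-most g exceed d on a
    neighbourhood of t. Along an ultrafilter a lower bound that fails for f is violated near t by
    U-most g, so the lower epi-limit is also the upper one: this yields the hits, and the misses
    come from compactness of the segment. *)
Lemma XMp1_ultra_cvg (U : set_system (efun R)) : UltraFilter U -> U XMp1 ->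
  exists2 f, XMp1 f & forall k, (0 < k)%N -> U (Vk k f).
Proof.
move=> UU UX.
pose M (t e d : R) : set (efun R) := [set g | forall s, t - e <= s <= t + e -> (d%:E < g s)%E].
pose f : efun R := fun t => ereal_sup [set d%:E | d in [set d | exists2 e, 0 < e & U (M t e d)]].
have UXp : U (XMp R) by apply: filterS UX => g [].
have MP t d : (d%:E < f t)%E -> exists2 e, 0 < e & U (M t e d).
  move=> /ereal_sup_gt[_ [d' [e e0 UM] <-]]; rewrite lte_fin => dd'.
  exists e => //; apply: filterS UM => g gM s /gM; apply: le_lt_trans.
  by rewrite lee_fin ltW.
have Mf t e d : 0 < e -> U (M t e d) -> (d%:E <= f t)%E.
  by move=> e0 UM; apply: ereal_sup_ubound; exists d => //; exists e.
have f_ge0 t : (0 <= f t)%E.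
  rewrite leNgt; apply/negP => ft0.
  have [d d0 fd] : exists2 d, d < 0 & (f t < d%:E)%E.
    case: (f t) ft0 => [r| |]//=; last by exists (-1); rewrite ?ltNyr//; lra.
    by rewrite lte_fin => r0; exists (r / 2); rewrite ?lte_fin; lra.
  have UM : U (M t 1 d).
    apply: filterS UXp => g [_ [_ [g0 _]]] s _.
    by rewrite (lt_le_trans _ (g0 s))// lte_fin.
  by have := Mf t 1 d ltr01 UM; rewrite leNgt fd.
have f0 : (f 0%R <= 1)%E.
  rewrite leNgt; apply/negP => /MP[e e0 UM].
  have [g [gM [_ g1]]] := filter_ex (filterI UM UX).
  have := gM 0; rewrite sub0r add0r oppr_le0 ltW//= => /(_ isT).
  by rewrite ltNge g1.
have hit (t c e : R) : (f t < c%:E)%E -> 0 < e ->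
    U [set g | exists2 s, `|s - t| < e & (g s < c%:E)%E].
  move=> ftc e0.
  have [c' fc' c'c] : exists2 c', (f t < c'%:E)%E & c' < c.
    have := f_ge0 t; case: (f t) ftc => [r| |]//=.
    by rewrite !lte_fin => rc _; exists ((r + c) / 2); rewrite ?lte_fin; lra.
  have [UM|] := in_ultra_setVsetC (M t (e / 2) c') UU.
    have e20 : 0 < e / 2 by lra.
    by have := Mf _ _ _ e20 UM; rewrite leNgt fc'.
  apply: filterS => g /existsNP[s /not_implyP[/andP[s1 s2] /negP]].
  rewrite -leNgt => gs; exists s; first by rewrite ltr_norml; apply/andP; split; lra.
  by apply: (le_lt_trans gs); rewrite lte_fin.
have f_lsc : elsc f.
  move=> t a aft.
  have [d ad dft] : exists2 d : R, (a < d%:E)%E & (d%:E < f t)%E.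
    case: a aft => [a| |].
    - by move=> /EFin_lt_slack[e e0 aef]; exists (a + e) => //; rewrite lte_fin; lra.
    - by rewrite ltNge leey.
    - by move=> _; exists (-1); rewrite ?ltNyr// (lt_le_trans _ (f_ge0 t))// lte_fin; lra.
  have [e e0 UM] := MP _ _ dft.
  apply/nbhs_ballP; exists (e / 2) => /=; first lra.
  move=> s; rewrite /ball /= ltr_norml => /andP[s1 s2].
  apply: (lt_le_trans ad); apply: (@Mf _ (e / 2)); first lra.
  apply: filterS UM => g gM u /andP[u1 u2]; apply: gM; apply/andP; split; lra.
have f_cvx : econvex f.
  move=> x y t t01.
  have [t0|t0] := eqVneq t 0.
    by rewrite t0 mul0r subr0 mul1r add0r mul0e mul1e add0e.
  have [t1|t1] := eqVneq t 1.
    by rewrite t1 subrr mul0r mul1r addr0 mul0e mul1e adde0.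
  have tp : 0 < t < 1.
    by move: t01 => /andP[h1 h2]; rewrite !lt_neqAle (eq_sym 0) t0 t1 h1 h2.
  have [fx|] := leP +oo%E (f x).
    move: fx; rewrite leye_eq => /eqP ->.
    rewrite gt0_muley ?lte_fin; last by case/andP: tp.
    by rewrite addye ?leey// gt_eqF// (lt_le_trans (ltNyr 0))// mule_ge0// lee_fin subr_ge0; case/andP: t01.
  have [fy|] := leP +oo%E (f y).
    move: fy; rewrite leye_eq => /eqP -> _.
    rewrite [X in (_ <= _ + X)%E]gt0_muley ?lte_fin; last by rewrite subr_gt0; case/andP: tp.
    by rewrite addey ?leey// gt_eqF// (lt_le_trans (ltNyr 0))// mule_ge0// lee_fin; case/andP: t01.
  move=> fy fx.
  have [rx fxE] : exists rx, f x = rx%:E.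
    by exists (fine (f x)); rewrite fineK// ge0_fin_numE.
  have [ry fyE] : exists ry, f y = ry%:E.
    by exists (fine (f y)); rewrite fineK// ge0_fin_numE.
  rewrite fxE fyE -!EFinM -EFinD leNgt; apply/negP => /EFin_lt_slack[e e0].
  move=> /MP[r r0 UM].
  have Hx : U [set g | exists2 s, `|s - x| < r & (g s < (rx + e)%:E)%E].
    by apply: hit => //; rewrite fxE lte_fin; lra.
  have Hy : U [set g | exists2 s, `|s - y| < r & (g s < (ry + e)%:E)%E].
    by apply: hit => //; rewrite fyE lte_fin; lra.
  (* One [g] with hits within r of x and of y has, by its own convexity, a small value within r of
     the combined point, where membership in [M] forbids it. *)
  have [g [[[gM [s1 s1x gs1]] [s2 s2y gs2]] gX]] :=
    filter_ex (filterI (filterI (filterI UM Hx) Hy) UXp).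
  have := econvex_lt gX t01 gs1 gs2; rewrite ltNge => /negP; apply.
  have -> : t * (rx + e) + (1 - t) * (ry + e) = t * rx + (1 - t) * ry + e by ring.
  apply/ltW/gM; rewrite -ler_distl.
  have -> : t * s1 + (1 - t) * s2 - (t * x + (1 - t) * y) =
    t * (s1 - x) + (1 - t) * (s2 - y) by ring.
  move: tp => /andP[tp1 tp2].
  rewrite (le_trans (ler_normD _ _))// !normrM (gtr0_norm tp1) (@gtr0_norm _ (1 - t)); last lra.
  have -> : r = t * r + (1 - t) * r by ring.
  by rewrite lerD// ler_wpM2l ?ltW// subr_gt0.
have fX : XMp R f by split=> //; split=> //; split=> //; apply: (le_lt_trans f0); rewrite ltry.
exists f => //; apply: hit_miss_Vk => //.
move=> p q d fd.
have /compact_near_coveringP K := @segment_compact R p q.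
have Kn : U [set g | `[p, q] `<=` (fun t => (d%:E < g t)%E)].
  apply: (K _ U (fun g t => (d%:E < g t)%E)) => t; rewrite /= in_itv /= => /fd /MP[e e0 UM].
  exists (ball t e, M t e d); first by split => //; exact: nbhsx_ballx.
  move=> [s g] [/= ts gM]; apply: gM; rewrite -ler_distl distrC.
  exact: ltW.
by apply: filterS Kn => g gK t tpq; apply: gK; rewrite /= in_itv.
Qed.

(* Compactness of XMp1 in a cover-free form. *)
Lemma XMp1_ideal (I : set (set (efun R))) :
  I set0 -> (forall A B, I A -> I B -> I (A `|` B)) ->
  (forall A B, A `<=` B -> I B -> I A) ->
  (forall f, XMp1 f -> exists2 k, (0 < k)%N & I (Vk k f `&` XMp R)) ->
  I XMp1.
Proof.
move=> I0 IU IS Iloc; apply: contrapT => nI.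
(* The dual filter of the ideal, proper because [XMp1] is assumed outside it. An ultrafilter above
   it has a limit, and a neighbourhood of that limit lies in the ideal although the ultrafilter
   contains it. *)
pose F : set_system (efun R) := [set B | I (XMp1 `\` B)].
have FF : ProperFilter F.
  split; first by rewrite /F /= setD0.
  split.
  - by rewrite /F /= setDT.
  - by move=> A B; rewrite /F /= setDIr; exact: IU.
  - by move=> A B AB; rewrite /F /=; apply: IS; exact: setDS.
have [U [UU FU]] := ultraFilterLemma FF.
have UX : U XMp1 by apply: FU; rewrite /F /= setDv.
have [f fX UV] := XMp1_ultra_cvg UU UX.
have [k k0 Ik] := Iloc f fX.
have UC : U (~` (Vk k f `&` XMp R)).
  by apply: FU; rewrite /F /=; apply: IS Ik => g [_ /contrapT].
have [g [[gV gC] [gX _]]] := filter_ex (filterI (filterI (UV k k0) UC) UX).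
exact: gC.
Qed.

End Compactness.

(** * Laplace transforms of measures on the line; mixtures and truncations *)

Section Laplace.
Variable R : realType.
Implicit Types (nu : {measure set R -> \bar R}) (t s L : R).

Lemma measure_to_probability nu : nu setT = 1%E ->
  exists P : probability R R, forall A, P A = nu A.
Proof.
move=> m1; exists (mnormalize nu (\d_(0 : R) : probability R R)) => A.
by rewrite /= /mnormalize m1 /= onee_eq0 /= invr1 mule1.
Qed.

Definition lapE t : R -> \bar R := fun x => (expR (t * x))%:E.

Lemma measurable_lapE (D : set R) t : measurable_fun D (lapE t : R -> \bar R).
Proof.
apply: measurable_funTS; apply/measurable_EFinP; exact: measurableT_comp.
Qed.

Lemma lapE_ge0 t x : (0 <= lapE t x)%E.
Proof. by rewrite lee_fin expR_ge0. Qed.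

Hint Resolve measurable_lapE lapE_ge0 : core.

Definition lap nu : efun R := fun t => (\int[nu]_x lapE t x)%E.
Definition lapT nu L : efun R := fun t => (\int[nu]_(x in `[(- L)%R, L]) lapE t x)%E.

Lemma lap_ge0 nu t : (0 <= lap nu t)%E.
Proof. by apply: integral_ge0. Qed.

Lemma lapT_ge0 nu L t : (0 <= lapT nu L t)%E.
Proof. by apply: integral_ge0. Qed.

Lemma lapT_le nu L t : (lapT nu L t <= lap nu t)%E.
Proof. by apply: ge0_subset_integral. Qed.

Lemma lapT_mono nu L1 L2 t : L1 <= L2 -> (lapT nu L1 t <= lapT nu L2 t)%E.
Proof.
move=> L12; apply: ge0_subset_integral => //; apply: subset_itv; rewrite bnd_simp//.
by rewrite lerN2.
Qed.

Lemma lap0 nu : lap nu 0 = nu setT.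
Proof.
rewrite /lap (eq_integral (cst 1%E)) ?integral_cst ?mul1e//.
by move=> x _; rewrite /lapE mul0r expR0.
Qed.

Lemma lapT0 nu L : lapT nu L 0 = nu `[- L, L]%classic.
Proof.
rewrite /lapT (eq_integral (cst 1%E)) ?integral_cst ?mul1e//.
by move=> x _; rewrite /lapE mul0r expR0.
Qed.

Lemma lapT_gt nu t (a : \bar R) : (a < lap nu t)%E ->
  exists2 L, 0 < L & (a < lapT nu L t)%E.
Proof.
move=> alt.
pose F (n : nat) : set R := `[- n.+1%:R, n.+1%:R]%classic.
have FT : \bigcup_n F n = setT.
  rewrite -subTset => x _; exists (Num.truncn `|x|) => //.
  by rewrite /F /= in_itv /= -ler_norml ltW// truncnS_gt.
have cv := @ge0_nondecreasing_set_cvg_integral _ _ _ F (lapE t) nu.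
have {}cv : (\int[nu]_(x in F i) lapE t x)%E @[i --> \oo] --> lap nu t.
  rewrite /lap -FT; apply: cv => //.
    move=> m n mn; apply/subsetPset; apply: subset_itv; rewrite bnd_simp.
      by rewrite lerN2 ler_nat.
    by rewrite ler_nat.
  by move=> i; exact: measurable_itv.
have : \forall i \near \oo, (a < \int[nu]_(x in F i) lapE t x)%E.
  exact: (cv _ (open_ereal_gt' alt)).
by case=> N _ /(_ N (leqnn N)) h; exists N.+1%:R.
Qed.

(** On [[-L, L]] the exponents at s and t differ by at most |s - t| L. This makes truncated
    transforms stable in t, hence their supremum [lap] lower semicontinuous; comparison with t = 0
    gives positivity. *)
Lemma lapT_shift nu L s t : 0 <= L ->
  ((expR (- (`|s - t| * L)))%:E * lapT nu L t <= lapT nu L s)%E.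
Proof.
move=> L0; rewrite /lapT -ge0_integralZl ?lee_fin ?expR_ge0//.
apply: ge0_le_integral => //.
- by move=> x _; rewrite mule_ge0// lee_fin expR_ge0.
- by apply: measurable_funeM.
move=> x; rewrite /= in_itv /= -ler_norml => xL.
rewrite /lapE -EFinM lee_fin -expRD ler_expR.
have : (t - s) * x <= `|s - t| * L.
  by rewrite (le_trans (ler_norm _))// normrM distrC ler_wpM2l.
lra.
Qed.

Lemma lapT_near nu L t (a : \bar R) : 0 <= L ->
  (a < lapT nu L t)%E -> \forall s \near t, (a < lapT nu L s)%E.
Proof.
move=> L0 aL.
have : \forall s \near t, (a < (expR (- (`|s - t| * L)))%:E * lapT nu L t)%E.
  have cv : ((expR (- (`|s - t| * L)))%:E * lapT nu L t)%E @[s --> t] --> lapT nu L t.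
    rewrite -[X in _ --> X]mul1e; apply: cvgeM.
    - by case: (lapT nu L t) => [r| |] //=; rewrite oner_eq0.
    - apply/cvg_EFin; first exact: nearW.
      have h0 : - (`|s - t| * L) @[s --> t] --> (0 : R).
        suff : - (`|s - t| * L) @[s --> t] --> - (`|t - t| * L).
          by rewrite subrr normr0 mul0r oppr0.
        apply: cvgN; apply: cvgM; last exact: cvg_cst.
        by apply: cvg_norm; apply: cvgB; [exact: cvg_id | exact: cvg_cst].
      rewrite -expR0; exact: (cvg_comp _ _ h0 (@continuous_expR R 0)).
    - exact: cvg_cst.
  exact: (cv _ (open_ereal_gt' aL)).
apply: filterS => s /lt_le_trans; apply.
exact: lapT_shift.
Qed.

Lemma lap_lsc nu : elsc (lap nu).
Proof.
move=> t a /lapT_gt[L L0 /(lapT_near (ltW L0))].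
by apply: filterS => s /lt_le_trans; apply; exact: lapT_le.
Qed.

(** The tangent of the exponential at the mean [m] lies below the graph; averaging its values at a
    and b gives back exp(m). *)
Lemma expR_convex t a b : 0 <= t <= 1 ->
  expR (t * a + (1 - t) * b) <= t * expR a + (1 - t) * expR b.
Proof.
move=> /andP[t0 t1]; set m := t * a + (1 - t) * b.
have ha c : expR m * (1 + (c - m)) <= expR c.
  rewrite [X in _ <= expR X](_ : c = m + (c - m)); last by ring.
  by rewrite [leRHS]expRD ler_wpM2l ?expR_ge0// expR_ge1Dx.
apply: (@le_trans _ _ (t * (expR m * (1 + (a - m))) + (1 - t) * (expR m * (1 + (b - m))))).
  rewrite le_eqVlt; apply/orP; left; apply/eqP; rewrite /m; ring.
by rewrite lerD// ler_wpM2l// subr_ge0.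
Qed.

Lemma lap_convex nu : econvex (lap nu).
Proof.
move=> x y t t01; have /andP[t0 t1] := t01.
have t1' : 0 <= 1 - t by rewrite subr_ge0.
rewrite /lap -!ge0_integralZl ?lee_fin// -ge0_integralD//.
- apply: ge0_le_integral => //.
  + by apply: emeasurable_funD; apply: measurable_funeM.
  move=> z _; rewrite /lapE -!EFinM -EFinD lee_fin mulrDl -!mulrA.
  exact: expR_convex.
- by move=> z _; rewrite mule_ge0// lee_fin.
- by apply: measurable_funeM.
- by move=> z _; rewrite mule_ge0// lee_fin.
- by apply: measurable_funeM.
Qed.

Lemma lap_gt0 nu t : (0 < nu setT)%E -> (0 < lap nu t)%E.
Proof.
rewrite -lap0 => /lapT_gt[L L0 nuL].
apply: (lt_le_trans _ (lapT_le nu L t)).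
apply: (lt_le_trans _ (lapT_shift nu t 0 (ltW L0))).
by rewrite mule_gt0// lte_fin expR_gt0.
Qed.

Lemma mgfE (nu : probability R R) : mgf nu = lap nu.
Proof. by []. Qed.

Lemma mgf0 (nu : probability R R) : mgf nu 0 = 1%E.
Proof. by rewrite mgfE lap0; exact: probability_setT. Qed.

Lemma mgf_XMp (nu : probability R R) : XMp R (mgf nu).
Proof.
split; first exact: lap_lsc.
split; first exact: lap_convex.
by split; [move=> t; exact: lap_ge0 | rewrite mgf0 ltry].
Qed.

Lemma mgf_XM (nu : probability R R) : XM R (mgf nu).
Proof.
split; first exact: mgf_XMp.
split; last by exists nu.
by move=> t; apply: lap_gt0; rewrite [ltRHS]probability_setT lte_fin.
Qed.

Lemma XM_XMp1 f : XM R f -> XMp1 f.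
Proof.
move=> [fX [_ [nu fnu]]]; split => //.
by have [_ [_ [_ f0]]] := fX; rewrite fnu// mgf0.
Qed.

Lemma XM0 f : XM R f -> f 0 = 1%E.
Proof. by move=> [[_ [_ [_ f0]]] [_ [nu fnu]]]; rewrite fnu// mgf0. Qed.

Lemma XB_XM : XB R `<=` XM R.
Proof. by move=> _ [nu [c [_ ->]]]; exact: mgf_XM. Qed.

Lemma XB_dirac a : XB R (fun t => (expR (t * a))%:E).
Proof.
exists (\d_a : probability R R), `|a|; split.
  by rewrite /= diracE mem_set// /= in_itv /= -ler_norml.
apply/funext => t; rewrite /mgf.
have -> : (\int[\d_a]_x (expR (t * x))%:E)%E = ((\d_a) setT * lapE t a)%E.
  by apply: integral_dirac => //; exact: measurable_lapE.
by rewrite diracT mul1e.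
Qed.

Lemma mixture (s : R) (P Q : probability R R) : 0 <= s <= 1 ->
  exists M : probability R R,
    (forall A, measurable A -> M A = s%:E * P A + (1 - s)%:E * Q A)%E /\
    forall t, (mgf M t = s%:E * mgf P t + (1 - s)%:E * mgf Q t)%E.
Proof.
move=> /andP[s0 s1]; have s1' : 0 <= 1 - s by rewrite subr_ge0.
pose m1 : {measure set R -> \bar R} := mscale (NngNum s0) P.
pose m2 : {measure set R -> \bar R} := mscale (NngNum s1') Q.
pose m : {measure set R -> \bar R} := measure_add m1 m2.
have mE A : m A = (s%:E * P A + (1 - s)%:E * Q A)%E.
  by rewrite /m [LHS]measure_addE.
have m1E : m setT = 1%E.
  by rewrite mE !probability_setT !mule1 -EFinD addrC subrK.
have [M ME] := measure_to_probability m1E.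
exists M; split; first by move=> A _; rewrite ME mE.
move=> t; rewrite /mgf.
rewrite (eq_measure_integral m); last by move=> A _ _; exact: ME.
rewrite ge0_integral_measure_add//; last exact: measurable_lapE.
by rewrite !ge0_integral_mscale//; exact: measurable_lapE.
Qed.

Lemma XB_convex f g (s : R) : 0 <= s <= 1 -> XB R f -> XB R g ->
  XB R (fun t => (s%:E * f t + (1 - s)%:E * g t)%E).
Proof.
move=> s01 [P [c [Pc ->]]] [Q [c' [Qc ->]]].
have [M [MA MM]] := mixture P Q s01.
have full (nu : probability R R) (a b : R) : a <= b -> nu `[- a, a]%classic = 1%E ->
    nu `[- b, b]%classic = 1%E.
  move=> ab nua; apply/eqP; rewrite eq_le probability_le1//= -nua.
  apply: le_measure; rewrite ?inE//; apply: subset_itv; rewrite bnd_simp//.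
  by rewrite lerN2.
exists M, (Num.max c c'); split; last by apply/funext => t; rewrite MM.
rewrite MA// (full P c)// ?le_max ?lexx// (full Q c')// ?le_max ?lexx ?orbT//.
by rewrite !mule1 -EFinD addrC subrK.
Qed.

(** Mass outside [[-L, L]] is moved to 0, where an atom contributes its mass to the transform
    whatever t is; the error is thus the tail mass, uniformly in t. *)
Lemma XB_trunc (nu : probability R R) L : 0 < L ->
  exists2 g, XB R g & forall t, (lapT nu L t <= g t)%E /\
    (g t <= lapT nu L t + nu (~` `[(- L)%R, L]%classic))%E.
Proof.
move=> L0.
pose phi (x : R) : R := if x \in `[- L, L]%classic then x else 0.
have mphi : measurable_fun setT phi.
  apply: measurable_fun_ifT => //.
  by apply: (measurable_fun_bool true); rewrite setTI preimage_mem_true.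
pose phi' : {mfun R >-> R} := HB.pack phi (isMeasurableFun.Build _ _ _ _ phi mphi).
pose M : probability R R := distribution nu phi'.
have ME A : M A = nu (phi @^-1` A) by [].
exists (mgf M).
  exists M, L; split => //; rewrite ME -(probability_setT nu).
  congr (nu _); rewrite -subTset => x _ /=; rewrite /phi; case: ifPn => [/set_mem//|_].
  by rewrite in_itv /= oppr_le0 ltW.
move=> t.
have -> : mgf M t = (lapT nu L t + nu (~` `[(- L)%R, L]%classic))%E.
  rewrite /mgf ge0_integral_pushforward//; last exact: measurable_lapE.
  rewrite preimage_setT -(setUv `[- L, L]%classic) ge0_integral_setU//.
  - congr (_ + _)%E.
      by apply: eq_integral => x xL; rewrite /= /phi xL.
    rewrite (eq_integral (cst 1%E)) ?integral_cst ?mul1e//.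
      exact: measurableC.
    move=> x; rewrite inE /= => xL; rewrite /phi memNset//.
    by rewrite mulr0 expR0.
  - exact: measurableC.
  - by apply: measurable_funTS; apply: measurableT_comp => //; exact: measurable_lapE.
  - by move=> x _; rewrite lee_fin expR_ge0.
  - by apply/disj_setPCl.
by split => //; rewrite leeDl.
Qed.

End Laplace.

(** * Every element of [XM] is a limit of transforms of compactly supported laws *)

Section Approximation.
Variable R : realType.
Implicit Types (f g h : efun R).

Lemma inf_exists_small (a b c : R) : 0 < a -> 0 < b -> 0 < c ->
  exists2 s, 0 < s < 1 & s * c < a /\ s * c < b.
Proof.
move=> a0 b0 c0; pose m := Num.min a b / c.
have m0 : 0 < m by rewrite divr_gt0// lt_min a0.
have mc : m * c = Num.min a b by rewrite mulrVK// unitfE gt_eqF.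
exists (Num.min m 1 / 2).
  have : Num.min m 1 <= 1 by rewrite ge_min lexx orbT.
  have : 0 < Num.min m 1 by rewrite lt_min m0 ltr01.
  by move=> ? ?; apply/andP; split; lra.
have h : Num.min m 1 / 2 * c < Num.min a b.
  rewrite -mc ltr_pM2r//.
  have : Num.min m 1 <= m by rewrite ge_min lexx.
  have : 0 < Num.min m 1 by rewrite lt_min m0 ltr01.
  lra.
by move: h; rewrite lt_min => /andP[].
Qed.

(** Along the segment towards b, lower semicontinuity bounds [f b] by the lower limit of the common
    values, and convexity of [h], finite at a, bounds that limit by [h b]. *)
Lemma endpoint_le f h (a b : R) : XMp R f -> XMp R h -> (h a < +oo)%E ->
  (forall s, 0 < s < 1 -> f (s * a + (1 - s) * b)%R = h (s * a + (1 - s) * b)%R) ->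
  (f b <= h b)%E.
Proof.
move=> fX hX ha fh; rewrite leNgt; apply/negP => hf.
have [r hb r0] := XMp_fin hX (lt_le_trans hf (leey _)).
have [ra har ra0] := XMp_fin hX ha.
move: hf; rewrite hb => /EFin_lt_slack[e e0].
have [fl _] := fX; move=> /fl /nbhs_ballP[d /= d0 Bd].
pose c := `|a - b| + ra + 1.
have c0 : 0 < c by rewrite /c; have := normr_ge0 (a - b); lra.
have [s s01 [sd se]] := inf_exists_small d0 e0 c0.
have /andP[s0 s1] := s01.
have := Bd (s * a + (1 - s) * b).
rewrite /ball /= => /(_ _)/[dup] _.
have -> : b - (s * a + (1 - s) * b) = s * (b - a) by ring.
rewrite normrM gtr0_norm// distrC.
have -> : s * `|a - b| < d.
  apply: le_lt_trans sd; rewrite ler_wpM2l ?ltW// /c; lra.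
move=> /(_ isT); rewrite fh//.
have [_ [hc _]] := hX.
have s01' : 0 <= s <= 1 by rewrite !ltW.
have := hc a b s s01'; rewrite har hb -!EFinM -EFinD => h1 h2.
have := lt_le_trans h2 h1; rewrite lte_fin.
have : s * ra <= s * c by rewrite ler_wpM2l ?ltW// /c; have := normr_ge0 (a - b); lra.
have : s * r >= 0 by rewrite mulr_ge0// ltW.
lra.
Qed.

Lemma endpoint_eq f h (a b : R) : XMp R f -> XMp R h ->
  (f a < +oo)%E -> (h a < +oo)%E ->
  (forall s, 0 < s < 1 -> f (s * a + (1 - s) * b)%R = h (s * a + (1 - s) * b)%R) ->
  f b = h b.
Proof.
move=> fX hX fa ha fh; apply/eqP; rewrite eq_le !(endpoint_le (a := a))//.
by move=> s s01; rewrite fh.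
Qed.

Lemma dom_convex f (a b t : R) : XMp R f -> (f a < +oo)%E -> (f b < +oo)%E ->
  a <= t <= b -> (f t < +oo)%E.
Proof.
move=> fX fa fb /andP[at' tb].
have [ab|ab] := eqVneq a b.
  by have -> : t = b by apply/eqP; rewrite eq_le tb -ab at'.
have [ra far _] := XMp_fin fX fa; have [rb fbr _] := XMp_fin fX fb.
have ab' : 0 < b - a by rewrite subr_gt0 lt_neqAle ab (le_trans at').
pose s := (b - t) / (b - a).
have sE : s * (b - a) = b - t by rewrite /s mulrVK// unitfE gt_eqF.
have s01 : 0 <= s <= 1.
  rewrite /s; apply/andP; split; first by rewrite divr_ge0 ?subr_ge0// ltW// -subr_gt0.
  by rewrite ler_pdivrMr// mul1r lerD2l lerN2.
have [_ [fc _]] := fX.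
have := fc a b s s01; rewrite far fbr -!EFinM -EFinD.
have -> : s * a + (1 - s) * b = t by rewrite -[RHS](subKr b) -sE; ring.
by move/le_lt_trans; apply; rewrite ltry.
Qed.

Lemma expR_ge_sqr (x : R) : 0 <= x -> x ^+ 2 / 4 <= expR x.
Proof.
move=> x0; have h : x / 2 <= expR (x / 2).
  by apply: le_trans (expR_ge1Dx _); lra.
have -> : expR x = expR (x / 2) * expR (x / 2).
  by rewrite -expRD; congr expR; lra.
have -> : x ^+ 2 / 4 = (x / 2) * (x / 2) by field.
by apply: ler_pM => //; rewrite divr_ge0.
Qed.

(* An atom of mass e^{-bn}/n at n, where b = sup D: its transform vanishes on D and blows up beyond b. *)
Lemma escaping_atom (D : set R) : D 0 -> (forall s t, 0 <= t <= s -> D s -> D t) ->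
  exists e y : nat -> R, [/\ forall n, 0 <= e n <= n.+1%:R^-1,
    forall n t, D t -> e n * expR (t * y n) <= n.+1%:R^-1 &
    forall s t M, 0 <= s -> ~ D s -> s < t ->
      \forall n \near \oo, forall u, t <= u -> M <= e n * expR (u * y n)].
Proof.
move=> D0 Ddn.
(* When [D] contains the whole half-line nothing has to be cut off: atoms of mass zero do, and the
   last claim is void. *)
have [[s0 [s00 Ds0]]|H] := pselect (exists s, 0 <= s /\ ~ D s); last first.
  exists (fun=> 0), (fun=> 0); split.
  - by move=> n; rewrite lexx invr_ge0 ler0n.
  - by move=> n t _; rewrite mul0r invr_ge0 ler0n.
  - by move=> s t M s0 Ds; exfalso; apply: H; exists s.
pose S := [set s | 0 <= s /\ ~ D s].
have Sinf : has_inf S by split; [exists s0 | exists 0 => s []].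
pose b := inf S.
have b0 : 0 <= b by apply: lb_le_inf => [|s []//]; exists s0.
have Db t : D t -> t <= b.
  move=> Dt; rewrite leNgt; apply/negP => /(inf_lt (ex_intro _ s0 (conj s00 Ds0))).
  by move=> [s [sp Ds] st]; apply: Ds; apply: (Ddn t) => //; rewrite sp ltW.
have bS s : 0 <= s -> ~ D s -> b <= s.
  by move=> sp Ds; apply: ge_inf => //; case: Sinf.
exists (fun n => expR (- (b * n.+1%:R)) / n.+1%:R), (fun n => n.+1%:R).
have n0 (n : nat) : 0 < n.+1%:R :> R by rewrite ltr0n.
split.
- move=> n; rewrite divr_ge0 ?expR_ge0//= ler_pdivrMr// mulVf ?gt_eqF//.
  by rewrite -expR0 ler_expR oppr_le0 mulr_ge0.
- move=> n t /Db tb; rewrite mulrAC -expRD ler_pdivrMr// mulVf ?gt_eqF//.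
  by rewrite -expR0 ler_expR addrC subr_le0 ler_wpM2r.
move=> s t M sp Ds st.
have tb : 0 < t - b by rewrite subr_gt0 (le_lt_trans (bS _ sp Ds)).
(* With N = n + 1, this is the threshold for (t - b)^2 N^2 / 4 >= |M| N; the N on the right undoes
   the division by N in the mass of the atom. *)
pose K := `|M| * 4 / (t - b) ^+ 2.
exists (Num.truncn K) => // n /= nK u tu.
have nK' : K <= n.+1%:R by rewrite (le_trans (ltW (truncnS_gt K)))// ler_nat.
rewrite mulrAC -expRD ler_pdivlMr//.
apply: (@le_trans _ _ (expR ((t - b) * n.+1%:R))); last first.
  by rewrite ler_expR [leRHS]addrC -(mulrBl n.+1%:R) ler_wpM2r ?ler0n// lerB.
apply: le_trans (expR_ge_sqr _); last by rewrite mulr_ge0// ltW.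
rewrite (_ : _ / 4 = ((t - b) ^+ 2 / 4 * n.+1%:R) * n.+1%:R); last by field.
rewrite ler_wpM2r ?ler0n//.
apply: (le_trans (ler_norm M)).
apply: (@le_trans _ _ ((t - b) ^+ 2 / 4 * K)); last first.
  by rewrite ler_wpM2l// divr_ge0// sqr_ge0.
by rewrite le_eqVlt; apply/orP; left; apply/eqP; rewrite /K; field; rewrite gt_eqF.
Qed.

(** The transform of [nu] may be finite where [f] is infinite, so truncating [nu] does not suffice.
    Two escaping atoms, one for each end of the effective domain, are mixed in. *)
Lemma XM_sub_closure f : XM R f -> AWclosure (XB R) f.
Proof.
move=> fXM; have [fX [fpos [nu fnu]]] := fXM; split => // k k0.
have nuX := mgf_XMp nu.
have f0 : (f 0%R < +oo)%E by have [_ [_ []]] := fX.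
pose D := [set t | (f t < +oo)%E].
have [e1 [y1 [e1b D1 esc1]]] : exists e y : nat -> R, [/\ forall n, 0 <= e n <= n.+1%:R^-1,
    forall n t, D t -> e n * expR (t * y n) <= n.+1%:R^-1 &
    forall s t M, 0 <= s -> ~ D s -> s < t ->
      \forall n \near \oo, forall u, t <= u -> M <= e n * expR (u * y n)].
  by apply: escaping_atom => // s t t0s Ds; exact: (dom_convex fX f0 Ds t0s).
have [e2 [y2 [e2b D2 esc2]]] : exists e y : nat -> R, [/\ forall n, 0 <= e n <= n.+1%:R^-1,
    forall n t, D (- t) -> e n * expR (t * y n) <= n.+1%:R^-1 &
    forall s t M, 0 <= s -> ~ D (- s) -> s < t ->
      \forall n \near \oo, forall u, t <= u -> M <= e n * expR (u * y n)].
  apply: (@escaping_atom [set t | D (- t)]) => /=; first by rewrite oppr0.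
  move=> s t /andP[t0 ts] Ds; apply: (dom_convex fX Ds f0).
  by rewrite lerN2 ts oppr_le0.
have n0 (n : nat) : 0 < n.+1%:R :> R by rewrite ltr0n.
have n1 (n : nat) : n.+1%:R^-1 <= 1 :> R by rewrite invf_le1// ler1n.
(* The upper bound serves the hits; the lower bounds by the truncated transform and by each atom
   alone serve the misses. The right atom loses a factor because the left one is mixed in after
   it. *)
have /choice[G GP] : forall n, exists g, [/\ XB R g,
    forall t, (g t <= (e1 n * expR (t * y1 n) + e2 n * expR (- t * y2 n))%:E
       + (lapT nu n.+1%:R t + nu (~` `[(- n.+1%:R)%R, n.+1%:R]%classic)))%E,
    forall t, (((1 - 2 * n.+1%:R^-1))%:E * lapT nu n.+1%:R t <= g t)%E,
    forall t, (((1 - n.+1%:R^-1) * (e1 n * expR (t * y1 n)))%:E <= g t)%E &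
    forall t, ((e2 n * expR (- t * y2 n))%:E <= g t)%E].
  move=> n; have /andP[e1p e1n] := e1b n; have /andP[e2p e2n] := e2b n.
  have e101 : 0 <= e1 n <= 1 by rewrite e1p (le_trans e1n).
  have e201 : 0 <= e2 n <= 1 by rewrite e2p (le_trans e2n).
  have [T TB TP] := XB_trunc nu (n0 n).
  have e1m : 0 <= 1 - e1 n by have := n1 n; lra.
  have e2m : 0 <= 1 - e2 n by have := n1 n; lra.
  have T0 t : (0 <= T t)%E by have [[_ [_ [T0 _]]] _] := XB_XM TB.
  have u0 t : 0 <= e1 n * expR (t * y1 n) by rewrite mulr_ge0 ?expR_ge0.
  have v0 t : 0 <= e2 n * expR (- t * y2 n) by rewrite mulr_ge0 ?expR_ge0.
  have w0 t : (0 <= (1 - e1 n)%:E * T t)%E by rewrite mule_ge0// lee_fin.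
  have := XB_convex e201 (XB_dirac (- y2 n)) (XB_convex e101 (XB_dirac (y1 n)) TB).
  set g := (X in XB R X) => gB.
  have gE t : g t = ((e2 n * expR (- t * y2 n))%:E + (1 - e2 n)%:E *
      ((e1 n * expR (t * y1 n))%:E + (1 - e1 n)%:E * T t))%E.
    by rewrite /g -!EFinM mulrN mulNr.
  have le1 (a : R) (x : \bar R) : (0 <= a)%R -> (0 <= x)%E -> ((1 - a)%:E * x <= x)%E.
    by move=> a0 x0; rewrite -[leRHS]mul1e lee_wpmul2r// lee_fin; lra.
  exists g; split => // t; rewrite gE.
  - have -> (x y : R) (z : \bar R) : ((x + y)%:E + z = y%:E + (x%:E + z))%E.
      by rewrite addeA -EFinD (addrC x).
    apply: leeD => //.
    apply: (le_trans (le1 _ _ e2p _)); first by rewrite adde_ge0// lee_fin.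
    by rewrite leeD// (le_trans (le1 _ _ e1p _))//; case: (TP t).
  - apply: (@le_trans _ _ ((1 - e2 n)%:E * ((1 - e1 n)%:E * T t))%E); last first.
      apply: (@le_trans _ _ ((1 - e2 n)%:E * ((e1 n * expR (t * y1 n))%:E + (1 - e1 n)%:E * T t))%E).
        by rewrite lee_wpmul2l ?lee_fin// leeDr// lee_fin.
      by rewrite leeDr// lee_fin.
    rewrite muleA -EFinM.
    apply: (@le_trans _ _ (((1 - e2 n) * (1 - e1 n))%:E * lapT nu n.+1%:R t)%E).
      rewrite lee_wpmul2r ?lapT_ge0// lee_fin.
      have : 0 <= e1 n * e2 n by rewrite mulr_ge0.
      by move: e1n e2n; set m := n.+1%:R^-1; lra.
    by rewrite lee_wpmul2l ?lee_fin ?mulr_ge0//; case: (TP t).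
  - apply: (@le_trans _ _ ((1 - e2 n)%:E * (e1 n * expR (t * y1 n))%:E)%E).
      by rewrite -EFinM lee_fin ler_wpM2r// lerD2l lerN2.
    apply: (@le_trans _ _ ((1 - e2 n)%:E * ((e1 n * expR (t * y1 n))%:E + (1 - e1 n)%:E * T t))%E).
      by rewrite lee_wpmul2l ?lee_fin// leeDl.
    by rewrite leeDr// lee_fin.
  - by rewrite leeDl// mule_ge0 ?lee_fin// adde_ge0// lee_fin.
pose F := G @ \oo.
suff : F (Vk k f).
  move=> FV; have [n Vn] := @filter_ex _ \oo _ _ FV.
  have [gB _ _ _ _] := GP n; exists (G n); split => //; split => //.
  by have [] := XB_XM gB.
have nuT (e : R) : 0 < e -> \forall n \near \oo, (nu (~` `[(- n.+1%:R)%R, n.+1%:R]%classic) <= e%:E)%E.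
  move=> e_gt0.
  have : ((1 - e)%:E < lap nu 0%R)%E by rewrite -mgfE mgf0 lte_fin; lra.
  move=> /lapT_gt[L L0 nuL]; exists (Num.truncn L) => // n /= nL.
  have Ln : L <= n.+1%:R by rewrite (le_trans (ltW (truncnS_gt L)))// ler_nat.
  rewrite probability_setC// -lapT0.
  have := lt_le_trans nuL (lapT_mono nu 0 Ln).
  have : (lapT nu n.+1%:R 0%R < +oo)%E.
    by rewrite lapT0 (le_lt_trans (probability_le1 _ _))// ltry.
  have := lapT_ge0 nu n.+1%:R 0.
  case: (lapT nu n.+1%:R 0%R) => [r| |]//= _ _.
  by rewrite lte_fin -EFinB lee_fin; lra.
have inv_near (e : R) : 0 < e -> \forall n \near \oo, n.+1%:R^-1 < e.
  by move=> e_gt0; exact: (near_infty_natSinv_lt (PosNum e_gt0)).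
apply: (@hit_miss_Vk _ F f _ _ fX _ _ k k0).
- by exists 0%N => // n _; have [gB _ _ _ _] := GP n; have [] := XB_XM gB.
- move=> t c e ftc e0.
  have Dt : D t by rewrite /D /= (lt_trans ftc)// ltry.
  have [r ftr r0] := XMp_fin fX Dt.
  move: ftc; rewrite ftr lte_fin => rc.
  pose d := (c - r) / 6; have d0 : 0 < d by rewrite /d; lra.
  suff : \forall n \near \oo, exists2 s, `|s - t| < e & (G n s < c%:E)%E by [].
  near=> n; exists t; first by rewrite subrr normr0.
  have [_ gle _ _ _] := GP n; apply: (le_lt_trans (gle t)).
  have nd : n.+1%:R^-1 < d by near: n; exact: inv_near.
  have nn : (nu (~` `[(- n.+1%:R)%R, n.+1%:R]%classic) <= d%:E)%E by near: n; exact: nuT.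
  have h1 := D1 n t Dt; have h2 := D2 n (- t).
  move: h2; rewrite opprK => /(_ Dt) h2.
  have h3 : (lapT nu n.+1%:R t <= r%:E)%E by rewrite -ftr (fnu t Dt) lapT_le.
  apply: (@le_lt_trans _ _ ((n.+1%:R^-1 + n.+1%:R^-1)%:E + (r%:E + d%:E))%E).
    by rewrite leeD// ?leeD// lee_fin lerD.
  rewrite -!EFinD lte_fin; move: nd; set m := n.+1%:R^-1; rewrite /d; lra.
move=> p q d fd.
have /compact_near_coveringP K := @segment_compact R p q.
have Kn : \forall n \near \oo, `[p, q] `<=` (fun t => (d%:E < G n t)%E).
  apply: (K _ \oo (fun n t => (d%:E < G n t)%E)) => t; rewrite /= in_itv /= => /fd dft.
  (* Either [nu] itself already exceeds d near t, or [f t] differs from the transform of [nu], hence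
     is infinite, and an atom has to do the work. *)
  have [dl|ld] := ltP d%:E (lap nu t).
    have [e e0 /lapT_gt[L L0 /(lapT_near (ltW L0)) nL]] := EFin_lt_slack dl.
    (* The second bound on 1 / (n + 1) ensures (1 - 2 / (n + 1)) (d + e) >= d, the first keeps that
       factor positive. *)
    exists ([set s | ((d + e)%:E < lapT nu L s)%E], [set n | n.+1%:R^-1 < Num.min (2^-1) (e / (2 * (`|d| + e))) /\ L <= n.+1%:R]).
      split => //=; near=> n; split.
        near: n; apply: inv_near; rewrite lt_min invr_gt0 ltr0n/= divr_gt0//.
        by rewrite mulr_gt0//; have := normr_ge0 d; lra.
      by near: n; exists (Num.truncn L) => // m /= mL; rewrite (le_trans (ltW (truncnS_gt L)))// ler_nat.
    move=> [s n] /= [sL []]; rewrite lt_min => /andP[n2 ne] Ln.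
    have [gB _ gl _ _] := GP n.
    have [d0|d0] := ltP d 0.
      have [_ [gpos _]] := XB_XM gB.
      by rewrite (lt_trans _ (gpos s))// lte_fin.
    apply: lt_le_trans (gl s).
    have h : ((d + e)%:E < lapT nu n.+1%:R s)%E by rewrite (lt_le_trans sL)// lapT_mono.
    apply: (@le_lt_trans _ _ ((1 - 2 * n.+1%:R^-1)%:E * (d + e)%:E)%E).
      rewrite -EFinM lee_fin.
      move: ne; rewrite ger0_norm// ltr_pdivlMr; last by lra.
      set m := n.+1%:R^-1; lra.
    by rewrite lte_pmul2l ?lte_fin//; move: n2; set m := n.+1%:R^-1; lra.
  have Dt : ~ D t.
    by rewrite /D /= => Dt; move: dft; rewrite fnu// mgfE ltNge ld.
  have tn0 : t != 0 by apply: contra_notN Dt => /eqP ->.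
  (* The point t is strictly beyond the domain: if [f] were finite on the open segment from 0 to t,
     it would agree there with the transform of [nu], and by [endpoint_eq] also at t. This leaves
     room for a neighbourhood on which the atom blows up. *)
  have [s s01 Ds] : exists2 s, 0 < s < 1 & ~ D (s * t).
    apply: contrapT => H.
    have fst s : 0 < s < 1 -> D (s * t).
      by move=> s01; apply: contrapT => Ds; apply: H; exists s.
    have : f t = lap nu t.
      apply: (@endpoint_eq _ _ 0 t fX nuX f0) => //.
        by rewrite mgf0 ltry.
      move=> s s01; rewrite mulr0 add0r; apply: fnu; apply: fst.
      by move: s01 => /andP[? ?]; apply/andP; split; lra.
    by move=> ft; move: dft; rewrite ft ltNge ld.
  have /andP[s0 s1] := s01.
  have [t0|t0] := ltP 0 t.
    have st : s * t < t by rewrite gtr_pMl.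
    pose t1 := (s * t + t) / 2.
    exists ([set u : R | t1 < u], [set n : nat | n.+1%:R^-1 < 2^-1 :> R /\ (forall u, t1 <= u -> 2 * `|d| + 1 <= e1 n * expR (u * y1 n))]).
      split => /=.
        have t1t : t1 < t by rewrite /t1; lra.
        exact: (lt_nbhsr t1t).
      near=> n; split; first by near: n; apply: inv_near.
      near: n; apply: (esc1 (s * t)) => //; first by rewrite mulr_ge0// ltW.
      by rewrite /t1; lra.
    move=> [u n] /= [tu [n2 /(_ u (ltW tu)) h]].
    have [_ _ _ g1 _] := GP n; apply: lt_le_trans (g1 u); rewrite lte_fin.
    apply: (@lt_le_trans _ _ (2^-1 * (2 * `|d| + 1))).
      by have := ler_norm d; lra.
    have dn := normr_ge0 d.
    apply: ler_pM => //.
    by move: n2; set m := n.+1%:R^-1; lra.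
  have {}t0 : t < 0 by rewrite lt_neqAle tn0.
  have st : t < s * t.
    have : (1 - s) * t < 0 by rewrite nmulr_llt0// subr_gt0.
    lra.
  pose t1 := (s * t + t) / 2.
  exists ([set u : R | u < t1], [set n : nat | (forall u, - t1 <= u -> `|d| + 1 <= e2 n * expR (u * y2 n))]).
    split => /=.
      have t1t : t < t1 by rewrite /t1; lra.
      exact: (lt_nbhsl t1t).
    apply: (esc2 (- (s * t))) => //.
    - by rewrite oppr_ge0 mulr_ge0_le0// ltW.
    - by rewrite opprK.
    - by rewrite /t1; lra.
  move=> [u n] /= [tu /(_ (- u)) h].
  have [_ _ _ _ g2] := GP n; apply: lt_le_trans (g2 u); rewrite lte_fin.
  apply: lt_le_trans (h _); first by have := ler_norm d; lra.
  by rewrite lerN2 ltW.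
by apply: filterS Kn => n gK t tpq; apply: gK; rewrite /= in_itv.
Unshelve. all: by end_near. Qed.

End Approximation.

Section Interior.
Variable R : realType.
Implicit Types (f g : efun R).

(** By convexity [f] stays below c at points v1 < t < v2 close to t. A close [g] hits below c near
    each of them, still on its own side of t, and convexity of [g] encloses t. *)
Lemma Vk_upper f (t1 t t2 c : R) : XMp R f -> t1 < t < t2 ->
  (f t1 < +oo)%E -> (f t2 < +oo)%E -> (f t < c%:E)%E ->
  exists2 k, (0 < k)%N & forall g, XMp R g -> Vk k f g -> (g t < c%:E)%E.
Proof.
move=> fX /andP[t1t tt2] f1 f2 ftc.
have [r ftr r0] := XMp_fin fX (lt_trans ftc (ltry _)).
move: (ftc); rewrite ftr lte_fin => rc.
have side u : u != t -> (f u < +oo)%E -> exists2 v, (f v < c%:E)%E &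
    exists2 s, 0 < s < 1 & v = s * u + (1 - s) * t.
  move=> ut fu; have [ru fur ru0] := XMp_fin fX fu.
  have cr : 0 < c - r by rewrite subr_gt0.
  have ru1 : 0 < ru + 1 by lra.
  have [s s01 [sc _]] := inf_exists_small cr cr ru1.
  have /andP[s0 s1] := s01.
  exists (s * u + (1 - s) * t); last by exists s.
  have [_ [fc _]] := fX; have s01' : 0 <= s <= 1 by rewrite !ltW.
  have := fc u t s s01'.
  rewrite fur ftr -!EFinM -EFinD => /le_lt_trans; apply; rewrite lte_fin.
  have : 0 <= s * r by rewrite mulr_ge0// ltW.
  lra.
have t1t' : t1 != t by rewrite lt_eqF.
have t2t' : t2 != t by rewrite gt_eqF.
have [v1 fv1 [s s01 v1E]] := side _ t1t' f1.
have [v2 fv2 [u u01 v2E]] := side _ t2t' f2.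
have v1t : v1 < t.
  have /andP[s0 s1] := s01; have : s * (t - t1) > 0 by rewrite mulr_gt0// subr_gt0.
  by rewrite v1E; lra.
have v2t : t < v2.
  have /andP[s0 s1] := u01; have : u * (t2 - t) > 0 by rewrite mulr_gt0// subr_gt0.
  by rewrite v2E; lra.
have d1 : 0 < t - v1 by rewrite subr_gt0.
have d2 : 0 < v2 - t by rewrite subr_gt0.
have [k1 k10 h1] := Vk_hit fX fv1 d1.
have [k2 k20 h2] := Vk_hit fX fv2 d2.
exists (maxn k1 k2); first by rewrite leq_max k10.
move=> g gX gV.
have [w1] := h1 g gX (Vk_le k10 (leq_maxl _ _) fX gX gV).
rewrite ltr_norml => /andP[_ w1t] gw1.
have [w2] := h2 g gX (Vk_le k20 (leq_maxr _ _) fX gX gV).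
rewrite ltr_norml => /andP[w2t _] gw2.
have w12 : 0 < w2 - w1 by lra.
pose l := (w2 - t) / (w2 - w1).
have lE : l * (w2 - w1) = w2 - t by rewrite /l mulrVK// unitfE gt_eqF.
have l01 : 0 <= l <= 1.
  rewrite /l; apply/andP; split; first by rewrite divr_ge0//; lra.
  by rewrite ler_pdivrMr// mul1r; lra.
have := econvex_lt gX l01 gw1 gw2.
have -> : l * w1 + (1 - l) * w2 = t by rewrite -[RHS](subKr w2) -lE; ring.
by have -> : l * c + (1 - l) * c = c by ring.
Qed.

End Interior.

(** * Limits of distribution functions and comparison of integrals over bounded intervals *)

Section Helly.
Variable R : realType.

Lemma ultra_lim01 T (U : set_system T) (u : T -> R) : UltraFilter U ->
  (forall g, 0 <= u g <= 1) ->
  exists2 h, 0 <= h <= 1 & forall e, 0 < e -> U [set g | `|u g - h| < e].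
Proof.
move=> UU u01.
have := @segment_compact R 0 1.
move=> /(_ (u @ U))[].
  apply: (@filterS _ U _ setT); last exact: filterT.
  by move=> g _; rewrite /= in_itv; exact: u01.
move=> h [+ hcl]; rewrite /= in_itv /= => h01.
exists h => // e e0.
have [//|UC] := in_ultra_setVsetC [set g | `|u g - h| < e] UU.
have := hcl (u @` (~` [set g | `|u g - h| < e])) (ball h e).
case.
- apply: (@filterS _ U _ (~` [set g | `|u g - h| < e])) => // g ng; exists g => //.
- exact: nbhsx_ballx.
- by move=> _ [[g ng <-]]; rewrite /ball /= distrC => /ng.
Qed.

Lemma measure_of_cumulative (F : R -> R) : {homo F : x y / x <= y} ->
  (forall x e, 0 < e -> exists2 y, x < y & F y < F x + e) ->
  exists m : {measure set R -> \bar R},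
    forall a b, a <= b -> m `]a, b]%classic = (F b - F a)%:E.
Proof.
move=> Fnd Frc.
have rc (x : R) : F z @[z --> x^'+] --> F x.
  apply/cvgrPdist_lt => e e0; have [y xy Fy] := Frc x e e0.
  near=> z.
  have xz : x < z by near: z; exact: nbhs_right_gt.
  have zy : z < y by near: z; exact: nbhs_right_lt.
  rewrite distrC ger0_norm; last by rewrite subr_ge0 Fnd// ltW.
  by rewrite ltrBlDl (le_lt_trans _ Fy)// Fnd// ltW.
pose G : cumulative R R := HB.pack_for (cumulative R R) F (isCumulative.Build R _ R F Fnd rc).
pose l := lebesgue_stieltjes_measure G.
pose m : {measure set R -> \bar R} := HB.pack_for (measure R R) (l : set R -> \bar R)
  (isMeasure.Build _ R R l (measure0 l) (measure_ge0 l) (@measure_semi_sigma_additive _ _ _ l)).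
exists m => a b ab; change (lebesgue_stieltjes_measure G `]a, b]%classic = (F b - F a)%:E).
rewrite /lebesgue_stieltjes_measure /measure_extension measurable_mu_extE.
  exact: wlength_itv_bnd.
exact: is_ocitv.
Unshelve. all: by end_near. Qed.

(** A rational chosen in each gap between [H x] and [F x] determines x, because [F x <= H y] for x <
    y keeps the gaps disjoint. An interval made of jumps would be countable, hence Lebesgue null. *)
Lemma dense_continuity (H F : R -> R) (a b : R) : (forall x, H x <= F x) ->
  (forall x y, x < y -> F x <= H y) -> a < b -> exists2 x, a < x < b & F x = H x.
Proof.
move=> HF FH ab; apply: contrapT => nex.
have jump x : a < x < b -> H x < F x.
  by move=> axb; rewrite lt_neqAle HF andbT; apply/eqP => h; apply: nex; exists x.
have /choice[q qP] : forall x, exists q : rat, a < x < b -> H x < ratr q < F x.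
  move=> x; have [axb|] := boolP (a < x < b); last by exists 0.
  by have [q] := rat_in_itvoo (jump x axb); rewrite in_itv /= => qx; exists q.
have : countable `]a, b[%classic.
  apply/countable_injP; exists (fun x => pickle (q x)).
  move=> x y; rewrite !inE /= !in_itv /= => axb ayb /(pcan_inj pickleK) qxy.
  have /andP[x1 x2] := qP _ axb; have /andP[y1 y2] := qP _ ayb.
  apply/eqP; rewrite eq_le; apply/andP; split; rewrite leNgt; apply/negP => xy.
    by have := FH _ _ xy; rewrite leNgt (lt_trans x1)// qxy.
  by have := FH _ _ xy; rewrite leNgt (lt_trans y1)// -qxy.
move=> /countable_lebesgue_measure0.
rewrite lebesgue_measure_itv /= lte_fin ab -EFinB => /eqP.
by rewrite eqe subr_eq0 gt_eqF.
Qed.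

Definition lapI (nu : {measure set R -> \bar R}) (t a b : R) : \bar R :=
  (\int[nu]_(x in `]a, b]) lapE t x)%E.

Implicit Types nu : {measure set R -> \bar R}.

Lemma lapI_le nu t a b : (lapI nu t a b <= lap nu t)%E.
Proof. by apply: ge0_subset_integral => // *; [exact: measurable_lapE | exact: lapE_ge0]. Qed.

Lemma lapI_cat nu t a c b : a <= c <= b -> lapI nu t a b = (lapI nu t a c + lapI nu t c b)%E.
Proof.
move=> /andP[ac cb]; rewrite /lapI -ge0_integral_setU//.
- congr (integral _ _ _); apply/seteqP; split=> x /=; rewrite !in_itv /=.
    by move=> /andP[ax xb]; have [xc|cx] := leP x c; [left|right]; rewrite ?ax ?cx.
  by move=> [/andP[h1 h2]|/andP[h1 h2]]; apply/andP; split => //;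
    [exact: le_trans cb | exact: le_lt_trans h1].
- exact: measurable_lapE.
- by move=> *; exact: lapE_ge0.
- apply/disj_setPLR => x /=; rewrite !in_itv /= => /andP[_ xc] /andP[cx _].
  by move: xc; rewrite leNgt cx.
Qed.

Lemma lapI_bounds nu t a b h : a <= b -> b - a <= h ->
  ((expR (t * a - `|t| * h))%:E * nu `]a, b]%classic <= lapI nu t a b)%E /\
  (lapI nu t a b <= (expR (t * a + `|t| * h))%:E * nu `]a, b]%classic)%E.
Proof.
move=> ab bah.
have xb x : `]a, b]%classic x -> `|t * (x - a)| <= `|t| * h.
  rewrite /= in_itv /= => /andP[ax xb]; rewrite normrM ler_wpM2l// ger0_norm; lra.
rewrite -!integral_cst//; split; apply: ge0_le_integral => //.
- by move=> x _; rewrite lee_fin expR_ge0.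
- exact: measurable_lapE.
- move=> x /xb; rewrite ler_norml => /andP[h1 h2].
  rewrite lee_fin ler_expR; lra.
- by move=> *; exact: lapE_ge0.
- exact: measurable_lapE.
- move=> x /xb; rewrite ler_norml => /andP[h1 h2].
  rewrite lee_fin ler_expR; lra.
Qed.

(** The interval is cut at points of [D] into pieces so short that the integrand is constant up to
    the factor K; on each piece the comparison of masses becomes one of integrals. The two measures
    are kept symmetric so that both inequalities with the limit law follow. *)
Lemma lapI_compare T (U : set_system T) (N1 N2 : T -> {measure set R -> \bar R})
    (D : set R) : Filter U ->
  (forall a b, a < b -> exists2 x, a < x < b & D x) ->
  (forall a b e, D a -> D b -> a <= b -> 0 < e ->
    U [set g | (N1 g `]a, b]%classic <= N2 g `]a, b]%classic + e%:E)%E]) ->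
  forall t a b K e, D a -> D b -> a <= b -> 1 < K -> 0 < e ->
    U [set g | (lapI (N1 g) t a b <= K%:E * lapI (N2 g) t a b + e%:E)%E].
Proof.
move=> UF Dd N12 t a b K e Da Db ab K1 e0.
have [h h0 hK] : exists2 h, 0 < h & expR (`|t| * h + `|t| * h) <= K.
  (* Each of the two bounds of [lapI_bounds] costs a factor exp(|t| h). *)
  exists (ln K / (2 * (`|t| + 1))).
    by rewrite divr_gt0 ?ln_gt0// mulr_gt0//; have := normr_ge0 t; lra.
  rewrite -[leRHS]lnK ?posrE; last lra.
  rewrite ler_expR; have tp := normr_ge0 t.
  rewrite -mulrDl mulrA ler_pdivrMr; last by rewrite mulr_gt0//; lra.
  have : 0 < ln K by rewrite ln_gt0.
  nra.
have step a' b' e' : D a' -> D b' -> a' <= b' -> b' - a' <= h -> 0 < e' ->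
    U [set g | (lapI (N1 g) t a' b' <= K%:E * lapI (N2 g) t a' b' + e'%:E)%E].
  move=> Da' Db' ab' bah e'0.
  pose C := expR (t * a' + `|t| * h).
  have C0 : 0 < C by exact: expR_gt0.
  have e''0 : 0 < e' / C by rewrite divr_gt0.
  apply: filterS (N12 _ _ _ Da' Db' ab' e''0) => g gN.
  have [_ up] := lapI_bounds (N1 g) t ab' bah.
  have [lo _] := lapI_bounds (N2 g) t ab' bah.
  apply: (le_trans up).
  apply: (@le_trans _ _ (C%:E * (N2 g `]a', b']%classic + (e' / C)%:E))%E).
    by rewrite lee_wpmul2l// lee_fin ltW.
  rewrite ge0_muleDr ?lee_fin ?(ltW e''0)// -EFinM mulrC divfK ?gt_eqF// leeD2r//.
  apply: (@le_trans _ _ (K%:E * ((expR (t * a' - `|t| * h))%:E * N2 g `]a', b']%classic))%E).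
    rewrite muleA -EFinM lee_wpmul2r// lee_fin.
    apply: (@le_trans _ _ (expR (`|t| * h + `|t| * h) * expR (t * a' - `|t| * h))).
      by rewrite -expRD /C ler_expR; lra.
    by rewrite ler_wpM2r ?expR_ge0.
  by rewrite lee_wpmul2l// lee_fin; lra.
(* Cut points are taken in [D] between h / 2 and h ahead, so each piece advances by at least h / 2
   and n bounds the number of cuts. *)
have [n] : exists n : nat, b - a <= n%:R * (h / 2).
  exists (Num.truncn ((b - a) / (h / 2))).+1.
  by rewrite -ler_pdivrMr ?divr_gt0// ltW// truncnS_gt.
elim: n a e Da ab e0 => [|n IH] a' e' Da ab e'0 bn.
  by apply: step => //; move: bn; rewrite mul0r; lra.
have [bah|bah] := leP (b - a') h; first exact: step.
have [c /andP[c1 c2] Dc] := Dd (a' + h / 2) (a' + h) (ltac:(lra)).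
have ac : a' <= c by lra.
have cb : c <= b by lra.
have e2 : 0 < e' / 2 by lra.
have P1 := step _ _ _ Da Dc ac (ltac:(lra)) e2.
have P2 : U [set g | (lapI (N1 g) t c b <= K%:E * lapI (N2 g) t c b + (e' / 2)%:E)%E].
  by apply: IH => //; move: bn; rewrite -natr1 mulrDl mul1r; lra.
apply: filterS (filterI P1 P2) => g [/= h1 h2].
rewrite !(@lapI_cat _ _ a' c b) ?ac//.
apply: (le_trans (leeD h1 h2)).
have I0 nu u v : (0 <= lapI nu t u v)%E by apply: integral_ge0 => *; exact: lapE_ge0.
rewrite [X in (_ <= X + _)%E]ge0_muleDr ?I0// [leLHS]addeACA leeD2l// -EFinD lee_fin; lra.
Qed.

End Helly.

(** * Limits of transforms with value 1 at 0 belong to [XM] *)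

Section ClosureXB.
Variable R : realType.
Implicit Types (f g : efun R).

Lemma closure_ultra f : AWclosure (XB R) f ->
  exists2 U : set_system (efun R), UltraFilter U &
    U (XB R) /\ forall k, (0 < k)%N -> U (Vk k f).
Proof.
move=> [fX fcl].
pose F : set_system (efun R) := [set A | exists2 k, (0 < k)%N & Vk k f `&` XMp R `&` XB R `<=` A].
have FF : ProperFilter F.
  split.
    by move=> [k k0 h]; have [g gV] := fcl k k0; exact: (h g).
  split.
  - by exists 1%N.
  - move=> A B [k k0 kA] [l l0 lB]; exists (maxn k l); first by rewrite leq_max k0.
    move=> g [[gV gX] gB]; split; [apply: kA|apply: lB]; split => //; split => //.
      exact: (Vk_le k0 (leq_maxl _ _) fX gX gV).
    exact: (Vk_le l0 (leq_maxr _ _) fX gX gV).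
  - by move=> A B AB [k k0 kA]; exists k => //; exact: subset_trans AB.
have [U [UU FU]] := ultraFilterLemma FF; exists U => //; split.
  by apply: FU; exists 1%N => // g [].
by move=> k k0; apply: FU; exists k => // g [[]].
Qed.

(* Helly's selection principle along an ultrafilter. *)
Lemma limit_law (U : set_system (efun R)) : UltraFilter U -> exists (N : efun R -> probability R R) (m : {measure set R -> \bar R})
    (D : set R),
  [/\ forall g, XB R g -> g = mgf (N g),
      forall a b, a < b -> exists2 x, a < x < b & D x &
      forall a b e, D a -> D b -> a <= b -> 0 < e ->
       U [set g | (N g `]a, b]%classic <= m `]a, b]%classic + e%:E)%E] /\
       U [set g | (m `]a, b]%classic <= N g `]a, b]%classic + e%:E)%E] ].
Proof.
move=> UU.
have /choice[N NP] : forall g, exists nu : probability R R, XB R g -> g = mgf nu.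
  move=> g; have [[nu [c [_ h]]]|h] := pselect (XB R g); first by exists nu.
  by exists (\d_(0 : R) : probability R R).
pose u x g := fine (N g `]-oo, x]%classic).
have uE x g : N g `]-oo, x]%classic = (u x g)%:E.
  by rewrite fineK// fin_num_measure.
have u01 x g : 0 <= u x g <= 1.
  by rewrite -!lee_fin -uE measure_ge0 probability_le1.
have /choice[H HP] : forall x, exists h, 0 <= h <= 1 /\ forall e, 0 < e -> U [set g | `|u x g - h| < e].
  by move=> x; have [h h01 hP] := ultra_lim01 UU (u01 x); exists h.
have umono x y g : x <= y -> u x g <= u y g.
  move=> xy; rewrite -lee_fin -!uE le_measure ?inE//.
  by apply: subset_itvl; rewrite bnd_simp.
have Hmono x y : x <= y -> H x <= H y.
  move=> xy; apply/ler_addgt0Pr => e e0.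
  have e2 : 0 < e / 2 by lra.
  have [g [/= h1 h2]] := filter_ex (filterI ((HP x).2 _ e2) ((HP y).2 _ e2)).
  have := umono x y g xy; move: h1 h2; rewrite !ltr_norml => /andP[? ?] /andP[? ?].
  lra.
pose S x := [set H y | y in [set y | x < y]].
have Sinf x : has_inf (S x).
  split; first by exists (H (x + 1)), (x + 1) => //=; lra.
  by exists 0 => _ [y _ <-]; have [/andP[]] := HP y.
(* The limit [H] is only monotone. [F] is its right-continuous version, and interval masses converge
   when both endpoints are points where the two agree. *)
pose F x := inf (S x).
have HF x : H x <= F x.
  by apply: lb_le_inf; [case: (Sinf x) | move=> _ [y /= xy <-]; apply: Hmono; exact: ltW].
have FH x y : x < y -> F x <= H y.
  by move=> xy; apply: ge_inf; [case: (Sinf x) | exists y].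
have Fnd : {homo F : x y / x <= y}.
  move=> x y xy; apply: lb_le_inf; first by case: (Sinf y).
  by move=> _ [z /= yz <-]; apply: FH; exact: le_lt_trans yz.
have Frc x e : 0 < e -> exists2 y, x < y & F y < F x + e.
  move=> e0; have [|_ [y /= xy <-] Hy] := @inf_lt _ (S x) (F x + e) (Sinf x).1.
    by rewrite -/(F x) ltrDl.
  exists ((x + y) / 2); first lra.
  by apply: le_lt_trans Hy; apply: FH; lra.
have [m mE] := measure_of_cumulative Fnd Frc.
exists N, m, [set x | F x = H x]; split => //.
  by move=> a b ab; exact: dense_continuity.
move=> a b e Da Db ab e0.
have NE g : N g `]a, b]%classic = (u b g - u a g)%:E.
  rewrite (_ : `]a, b]%classic = `]-oo, b]%classic `\` `]-oo, a]%classic); last first.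
    apply/seteqP; split=> x /=; rewrite !in_itv /=.
      by move=> /andP[ax ->]; split => //; apply/negP; rewrite -ltNge.
    by move=> [-> /negP]; rewrite -ltNge => ->.
  have sub : `]-oo, a]%classic `<=` `]-oo, b]%classic by apply: subset_itvl; rewrite bnd_simp.
  rewrite EFinB -!uE -[X in (_ - N g X)%E](setIidr sub).
  by apply: measureD => //; apply: (le_lt_trans (probability_le1 _ _)); rewrite ?ltry.
have e2 : 0 < e / 2 by lra.
have h : U ([set g | `|u a g - H a| < e / 2] `&` [set g | `|u b g - H b| < e / 2]).
  exact: filterI ((HP a).2 _ e2) ((HP b).2 _ e2).
rewrite /= in Da Db.
split; apply: filterS h => g [/=]; rewrite !ltr_norml => /andP[? ?] /andP[? ?];
  rewrite NE mE// -EFinD lee_fin; lra.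
Qed.

Section ultra_pointwise.
Variables (f : efun R) (U : set_system (efun R)).
Hypotheses (fX : XMp R f) (UU : UltraFilter U) (UB : U (XB R)).
Hypothesis UV : forall k, (0 < k)%N -> U (Vk k f).

Let UX : U (XMp R).
Proof. by apply: filterS UB => g /XB_XM[]. Qed.

Lemma ultra_upper t1 t t2 (c : R) : t1 < t < t2 ->
  (f t1 < +oo)%E -> (f t2 < +oo)%E -> (f t < c%:E)%E -> U [set g | (g t < c%:E)%E].
Proof.
move=> t12 f1 f2 fc; have [k k0 kV] := Vk_upper fX t12 f1 f2 fc.
by apply: filterS (filterI (UV k0) UX) => g [gV gX]; exact: kV.
Qed.

Lemma ultra_lower t (c : R) : (c%:E < f t)%E -> U [set g | (c%:E < g t)%E].
Proof.
move=> fc.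
have ftt : forall s, t <= s <= t -> (c%:E < f s)%E.
  by move=> s h; rewrite (_ : s = t)//; apply/eqP; rewrite eq_le andbC.
have [k k0 kV] := Vk_miss fX ftt.
apply: filterS (filterI (UV k0) UX) => g [gV gX].
by apply: kV; rewrite ?lexx.
Qed.

End ultra_pointwise.

(** Chernoff's bound: on [A] the ratio of the integrands at t and t' is at most exp(-(t' - t) b).
    The sign of t' - t selects left or right tails. *)
Lemma lap_tail (nu : {measure set R -> \bar R}) (t t' : R) (A : set R) (b : R) : measurable A ->
  (forall x, A x -> (t' - t) * b <= (t' - t) * x) ->
  (\int[nu]_(x in A) lapE t x <= (expR (- ((t' - t) * b)))%:E * lap nu t')%E.
Proof.
move=> mA Ab.
apply: (@le_trans _ _ (\int[nu]_(x in A) ((expR (- ((t' - t) * b)))%:E * lapE t' x))%E).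
  apply: ge0_le_integral => //.
  - by move=> *; exact: lapE_ge0.
  - exact: measurable_lapE.
  - by apply: measurable_funeM; exact: measurable_lapE.
  move=> x /Ab h; rewrite /lapE -EFinM lee_fin -expRD ler_expR; lra.
rewrite ge0_integralZl ?lee_fin ?expR_ge0//; last 2 first.
- exact: measurable_lapE.
- by move=> *; exact: lapE_ge0.
rewrite lee_wpmul2l ?lee_fin ?expR_ge0//.
by apply: ge0_subset_integral => // *; [exact: measurable_lapE | exact: lapE_ge0].
Qed.

Lemma small_exp (C e : R) : 0 < C -> 0 < e -> exists B, forall x, B <= x -> expR (- x) * C <= e.
Proof.
move=> C0 e0; exists (- ln (e / C)) => x xB.
rewrite -ler_pdivlMr// -[leRHS]lnK ?posrE ?divr_gt0// ler_expR; lra.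
Qed.

Lemma lap_split (nu : {measure set R -> \bar R}) t a b : a <= b ->
  lap nu t = ((\int[nu]_(x in `]-oo, a]) lapE t x) + (lapI nu t a b + \int[nu]_(x in `]b, +oo[) lapE t x))%E.
Proof.
move=> ab; have m D : measurable_fun D (lapE t : R -> \bar R) by exact: measurable_lapE.
have p x : (0 <= lapE t x)%E by exact: lapE_ge0.
rewrite /lapI -ge0_integral_setU//; last first.
  apply/disj_setPLR => x /=; rewrite !in_itv /= => /andP[_ xb]; rewrite andbT.
  by move=> bx; move: xb; rewrite leNgt bx.
rewrite -ge0_integral_setU//; last 2 first.
- exact: measurableU.
- apply/disj_setPLR => x /=; rewrite !in_itv /= => xa; rewrite andbT.
  case=> [/andP[ax _]|bx]; first by move: xa; rewrite leNgt ax.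
  by move: xa; rewrite leNgt (le_lt_trans ab bx).
congr (integral _ _ _); apply/esym; rewrite -subTset => x _ /=; rewrite !in_itv /= andbT.
have [xa|ax] := leP x a; [by left | right].
by have [xb|bx] := leP x b; [left | right].
Qed.

(** Between two finite points of [f], bounded transforms on either side make the tails uniformly
    small, so the transforms converge to that of the limit law [m]; [endpoint_eq] extends the
    identity to every finite point. At 0 it shows that [m] has mass f(0) = 1. *)
Lemma closure_XM f : AWclosure (XB R) f -> f 0 = 1%E -> XM R f.
Proof.
move=> fcl f0; have [fX _] := fcl.
have f0y : (f 0%R < +oo)%E by rewrite f0 ltry.
(* If 0 is the only finite point, the condition on the law reduces to total mass one, and the Dirac
   mass at 0 serves. *)
have [[a [a0 fa]]|triv] := pselect (exists a, a != 0 /\ (f a < +oo)%E); last first.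
  have ty t : t != 0 -> f t = +oo%E.
    move=> t0; apply/eqP; rewrite -leye_eq leNgt; apply/negP => h.
    by apply: triv; exists t.
  split => //; split.
    by move=> t; have [->|t0] := eqVneq t 0; [rewrite f0 lte_fin | rewrite ty// ltry].
  exists (\d_(0 : R) : probability R R) => t.
  have [->|t0] := eqVneq t 0; first by rewrite mgf0.
  by rewrite ty.
have [U UU [UB UV]] := closure_ultra fcl.
have [N [m [D [NP Dd ND]]]] := limit_law UU.
have UN : U [set g | g = lap (N g)] by apply: filterS UB => g /NP.
have cmp1 t u v K e : D u -> D v -> u <= v -> 1 < K -> 0 < e ->
    U [set g | (lapI (N g) t u v <= K%:E * lapI m t u v + e%:E)%E].
  apply: (lapI_compare (N1 := fun g => N g) (N2 := fun=> m)) => // x y e' Dx Dy xy e'0.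
  by have [] := ND x y e' Dx Dy xy e'0.
have cmp2 t u v K e : D u -> D v -> u <= v -> 1 < K -> 0 < e ->
    U [set g | (lapI m t u v <= K%:E * lapI (N g) t u v + e%:E)%E].
  apply: (lapI_compare (N1 := fun=> m) (N2 := fun g => N g)) => // x y e' Dx Dy xy e'0.
  by have [] := ND x y e' Dx Dy xy e'0.
(* The Fatou half: upper bounds on [g t] pass to truncations of the transform of [m], and these
   exhaust it. No tail estimate enters. *)
have lap_le t r : f t = r%:E -> 0 <= r ->
    (forall d, 0 < d -> U [set g | (g t < (r + d)%:E)%E]) -> (lap m t <= r%:E)%E.
  move=> ftr r0 Ur; rewrite leNgt; apply/negP => /EFin_lt_slack[e e0 /lapT_gt[L L0 eL]].
  have [u /andP[_ uL] Du] := Dd (- L - 1) (- L) (ltac:(lra)).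
  have [v /andP[Lv _] Dv] := Dd L (L + 1) (ltac:(lra)).
  have uv : u <= v by lra.
  have eI : ((r + e)%:E < lapI m t u v)%E.
    apply: (lt_le_trans eL); apply: ge0_subset_integral => //.
    - exact: measurable_lapE.
    - by move=> *; exact: lapE_ge0.
    - by apply: subset_itv; rewrite bnd_simp// ltW.
  have d0 : 0 < e / 4 by lra.
  pose K := 1 + (e / 4) / (r + e).
  have re : 0 < r + e by lra.
  have K1 : 1 < K by rewrite /K ltrDl divr_gt0.
  have KE : K * (r + e) = r + e + e / 4 by rewrite /K mulrDl mul1r divfK// gt_eqF.
  have [g [[/= gN g1] g2]] :=
    filter_ex (filterI (filterI UN (Ur _ d0)) (cmp2 t u v K (e / 4) Du Dv uv K1 d0)).
  have h : (lapI (N g) t u v <= (r + e / 4)%:E)%E.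
    by rewrite (le_trans (lapI_le _ _ _ _))// -gN ltW.
  have : ((r + e)%:E < K%:E * (r + e / 4)%:E + (e / 4)%:E)%E.
    apply: (lt_le_trans eI); apply: (le_trans g2).
    by rewrite leeD2r// lee_wpmul2l// lee_fin; lra.
  rewrite -EFinM -EFinD lte_fin; nra.
have interior t t1 t2 : t1 < t < t2 -> (f t1 < +oo)%E -> (f t2 < +oo)%E -> f t = lap m t.
  move=> /andP[t1t tt2] f1 f2.
  have fty : (f t < +oo)%E by apply: (dom_convex fX f1 f2); rewrite !ltW.
  have [r ftr r0] := XMp_fin fX fty.
  have lr : (lap m t <= r%:E)%E.
    apply: lap_le => // d d0; apply: (ultra_upper fX UU UB UV (t1 := t1) (t2 := t2)) => //.
      by rewrite t1t.
    by rewrite ftr lte_fin; lra.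
  apply/eqP; rewrite eq_le ftr lr andbT leNgt; apply/negP => lm.
  have [l lE l0] : exists2 l, lap m t = l%:E & 0 <= l.
    exists (fine (lap m t)); last by rewrite fine_ge0// lap_ge0.
    by rewrite fineK// ge0_fin_numE ?lap_ge0// (lt_trans lm)// ltry.
  move: lm; rewrite lE lte_fin => lr'.
  (* Five errors of size at most e must fit into r - l: two tails, the additive term of the
     comparison, the effect of the factor K, and the slack in the lower bound on [g t]. *)
  pose e := (r - l) / 8; have e0 : 0 < e by rewrite /e; lra.
  (* The tails are tilted to points strictly between t1, t and t2: only there are the values of [g]
     bounded, as t1 and t2 may be ends of the domain. *)
  pose s1 := (t1 + t) / 2; pose s2 := (t + t2) / 2.
  have s1t : t1 < s1 < t by rewrite /s1; apply/andP; split; lra.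
  have s2t : t < s2 < t2 by rewrite /s2; apply/andP; split; lra.
  have /andP[s11 s12] := s1t; have /andP[s21 s22] := s2t.
  have fin s : t1 < s < t2 -> exists2 C, 0 < C & U [set g | (g s < C%:E)%E].
    move=> s12'; have fs : (f s < +oo)%E.
      by apply: (dom_convex fX f1 f2); move: s12' => /andP[? ?]; rewrite !ltW.
    have [rs fsE rs0] := XMp_fin fX fs.
    exists (rs + 1); first lra.
    by apply: (ultra_upper fX UU UB UV s12') => //; rewrite fsE lte_fin; lra.
  have [C1 C10 U1] := fin s1 (ltac:(apply/andP; split; lra)).
  have [C2 C20 U2] := fin s2 (ltac:(apply/andP; split; lra)).
  have [B1 HB1] := small_exp C10 e0.
  have [B2 HB2] := small_exp C20 e0.
  pose b1 := B1 / (s1 - t); pose b2 := B2 / (s2 - t).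
  have b1E : (s1 - t) * b1 = B1 by rewrite /b1 mulrC divfK// lt_eqF// subr_lt0.
  have b2E : (s2 - t) * b2 = B2 by rewrite /b2 mulrC divfK// gt_eqF// subr_gt0.
  pose M := `|b1| + `|b2| + 1.
  have b1n := ler_norm (- b1); have b2n := ler_norm b2; rewrite normrN in b1n.
  have b1p := normr_ge0 b1; have b2p := normr_ge0 b2.
  have [u /andP[u1 u2] Du] := Dd (- M - 1) (- M) (ltac:(lra)).
  have [v /andP[v1 v2] Dv] := Dd M (M + 1) (ltac:(lra)).
  have uv : u <= v by rewrite /M in u2 v1; lra.
  pose K := 1 + e / (l + 1).
  have l1 : 0 < l + 1 by lra.
  have K1 : 1 < K by rewrite /K ltrDl divr_gt0.
  have KE : K * (l + 1) = l + 1 + e by rewrite /K mulrDl mul1r divfK// gt_eqF.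
  have Ulow : U [set g | ((r - e)%:E < g t)%E].
    by apply: (ultra_lower fX UU UB UV); rewrite ftr lte_fin; lra.
  have [g [[[[/= gN gl] g1] g2] gI]] := filter_ex (filterI (filterI (filterI (filterI UN Ulow) U1) U2)
     (cmp1 t u v K e Du Dv uv K1 e0)).
  have T1 : (\int[N g]_(x in `]-oo, u]) lapE t x <= e%:E)%E.
    apply: (le_trans (@lap_tail (N g) t s1 _ u _ _)) => //.
      move=> x; rewrite /= in_itv /= => xu; rewrite ler_wnM2l//; lra.
    apply: (@le_trans _ _ ((expR (- ((s1 - t) * u)))%:E * C1%:E)%E).
      by rewrite lee_wpmul2l ?lee_fin ?expR_ge0// -gN ltW.
    rewrite -EFinM lee_fin; apply: HB1; rewrite -b1E ler_wnM2l//; first lra.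
    by rewrite /M in u2; lra.
  have T2 : (\int[N g]_(x in `]v, +oo[) lapE t x <= e%:E)%E.
    apply: (le_trans (@lap_tail (N g) t s2 _ v _ _)) => //.
      move=> x; rewrite /= in_itv /= andbT => vx; rewrite ler_wpM2l// ?ltW//; lra.
    apply: (@le_trans _ _ ((expR (- ((s2 - t) * v)))%:E * C2%:E)%E).
      by rewrite lee_wpmul2l ?lee_fin ?expR_ge0// -gN ltW.
    rewrite -EFinM lee_fin; apply: HB2; rewrite -b2E ler_wpM2l//; first lra.
    by rewrite /M in v1; lra.
  move: gl; rewrite gN (lap_split _ _ uv) ltNge => /negP; apply.
  apply: (@le_trans _ _ (e%:E + ((K%:E * l%:E + e%:E) + e%:E))%E).
    apply: leeD => //; apply: leeD => //.
    apply: (le_trans gI); rewrite leeD2r// lee_wpmul2l// ?lee_fin; last by rewrite -lE lapI_le.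
    lra.
  rewrite -EFinM -!EFinD lee_fin; rewrite /e in KE *; nra.
have m01 : (lap m 0%R <= 1%:E)%E.
  apply: lap_le => // d d0; apply: filterS UB => g gB.
  by rewrite /= (XM0 (XB_XM gB)) lte_fin; lra.
have lX : XMp R (lap m).
  split; first exact: lap_lsc.
  split; first exact: lap_convex.
  by split; [move=> t; exact: lap_ge0 | rewrite (le_lt_trans m01)// ltry].
have fm t : (f t < +oo)%E -> f t = lap m t.
  move=> ft.
  (* A second finite point makes t an end of a segment in the domain, whose open part is covered by
     [interior]. *)
  have [u ut fu] : exists2 u, u != t & (f u < +oo)%E.
    by have [->|t0] := eqVneq t 0; [exists a | exists 0; rewrite // eq_sym].
  have mid s : 0 < s < 1 -> f (s * u + (1 - s) * t) = lap m (s * u + (1 - s) * t).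
    move=> /andP[s0 s1].
    have [utl|tul] := ltP u t.
      apply: (interior _ u t) => //.
      have : 0 < s * (t - u) by rewrite mulr_gt0// subr_gt0.
      have : 0 < (1 - s) * (t - u) by rewrite mulr_gt0// subr_gt0.
      by move=> ? ?; apply/andP; split; lra.
    have {}tul : t < u by rewrite lt_neqAle eq_sym ut.
    apply: (interior _ t u) => //.
    have : 0 < s * (u - t) by rewrite mulr_gt0// subr_gt0.
    have : 0 < (1 - s) * (u - t) by rewrite mulr_gt0// subr_gt0.
    by move=> ? ?; apply/andP; split; lra.
  (* [endpoint_eq] wants a base point where both functions are finite. This is known at the
     midpoint, where they agree, but not yet for [lap m] at u. *)
  pose w := 2^-1 * u + (1 - 2^-1) * t.
  have half : 0 < (2^-1 : R) < 1 by apply/andP; split; lra.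
  have fw : (f w < +oo)%E.
    have [_ [fc _]] := fX.
    have [ru fur _] := XMp_fin fX fu; have [rt ftr _] := XMp_fin fX ft.
    apply: (le_lt_trans (fc u t 2^-1 _)); first by apply/andP; split; lra.
    by rewrite fur ftr -!EFinM -EFinD ltry.
  apply: (@endpoint_eq _ _ _ w t fX lX fw); first by rewrite -(mid _ half).
  move=> s /andP[s0 s1].
  have -> : s * w + (1 - s) * t = (s / 2) * u + (1 - s / 2) * t by rewrite /w; field.
  by apply: mid; apply/andP; split; lra.
have mT : m setT = 1%E by rewrite -lap0 -fm// f0.
have [P PE] := measure_to_probability mT.
have fP t : (f t < +oo)%E -> f t = mgf P t.
  move=> ft; rewrite fm// mgfE /lap; apply: eq_measure_integral => A _ _.
  exact/esym/PE.
split => //; split; last by exists P.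
move=> t; have [ft|] := ltP (f t) +oo%E; last by move=> h; rewrite (lt_le_trans _ h)// ltry.
by rewrite fP//; have [_ []] := mgf_XM P.
Qed.

End ClosureXB.

(** * Empirical transforms as functions of the sample, and measurability of open events *)

Section Empirical.
Variable R : realType.
Implicit Types (f g : efun R) (x y : nat -> R).

Definition em x (n : nat) : efun R := fun t => (n%:R^-1 * \sum_(i < n) expR (t * x i))%:E.

Lemma em_eq x y n : (forall i, (i < n)%N -> x i = y i) -> em x n = em y n.
Proof.
move=> xy; apply/funext => t; rewrite /em; congr ((_ * _)%:E).
by apply: eq_bigr => i _; rewrite xy.
Qed.

Lemma em_XB x n : XB R (em x n.+1).
Proof.
elim: n => [|n IH].
  have -> : em x 1 = (fun t => (expR (t * x 0%N))%:E).
    by apply/funext => t; rewrite /em big_ord1 invr1 mul1r.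
  exact: XB_dirac.
pose s : R := n.+1%:R / n.+2%:R.
have s01 : 0 <= s <= 1.
  by rewrite divr_ge0 ?ler0n//= ler_pdivrMr ?ltr0n// mul1r ler_nat.
have := XB_convex s01 IH (XB_dirac (x n.+1)); congr (XB R _).
apply/funext => t; rewrite /em -!EFinM -EFinD [in RHS](big_ord_recr n.+1)/=; congr (_%:E).
set S := (\sum_(i < n.+1) _); rewrite mulrDr mulrA; congr (_ * _ + _ * _).
  by rewrite /s mulrAC divff ?mul1r// pnatr_eq0.
have n2 : n.+2%:R != 0 :> R by rewrite pnatr_eq0.
by rewrite /s -[n.+2]addn1 natrD in n2 *; field.
Qed.

Lemma em_XM x n : XM R (em x n.+1).
Proof. exact/XB_XM/em_XB. Qed.

(** Without observations the average is the zero function; the event of an open set at n = 0 is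
    therefore empty. *)
Lemma em0_notXM x : ~ XM R (em x 0).
Proof. by move=> [_ [/(_ 0)]]; rewrite /em big_ord0 mulr0 ltxx. Qed.

Lemma em_gt0 x n t : (0 < em x n.+1 t)%E.
Proof. by have [_ []] := em_XM x n. Qed.

Lemma em_close x y n t d : (forall i, (i < n)%N -> `|x i - y i| < d) ->
  (em x n t <= (expR (`|t| * d))%:E * em y n t)%E.
Proof.
move=> xy; rewrite /em -EFinM lee_fin mulrCA ler_wpM2l ?invr_ge0 ?ler0n//.
rewrite mulr_sumr; apply: ler_sum => i _; rewrite -expRD ler_expR.
have : t * (x i - y i) <= `|t| * d.
  by rewrite (le_trans (ler_norm _))// normrM ler_wpM2l// ltW// xy.
lra.
Qed.

(** Continuity of the map from samples to transforms: by [em_close], moving the observations by less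
    than d changes the transform at t by a factor at most exp(|t| d), which preserves hits and
    misses. *)
Lemma AWopen_em_nbhs (G : set (efun R)) x n : AWopen (XM R) G -> G (em x n.+1) ->
  exists2 d, 0 < d & forall y, (forall i, (i < n.+1)%N -> `|y i - x i| < d) ->
    G (em y n.+1).
Proof.
move=> [_ Go] Gx; have [k [k0 kG]] := Go _ Gx.
pose F : set_system (efun R) := [set A | exists2 d, 0 < d & forall y,
  (forall i, (i < n.+1)%N -> `|y i - x i| < d) -> A (em y n.+1)].
have FF : Filter F.
  split.
  - by exists 1.
  - move=> A B [a a0 aA] [b b0 bB]; exists (Num.min a b); first by rewrite lt_min a0.
    move=> y h; split; [apply: aA|apply: bB] => i ii; have := h i ii;
      by rewrite lt_min => /andP[].
  - by move=> A B AB [a a0 aA]; exists a => // y h; apply/AB/aA.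
have FX : F (XMp R) by exists 1 => // y _; case: (em_XM y n).
have [fX _] := em_XM x n.
suff [d d0 dV] : F (Vk k (em x n.+1)).
  by exists d => // y h; apply: kG; split; [exact: dV | exact: em_XM].
apply: (hit_miss_Vk FF FX fX) => //.
- move=> t c e ftc e0.
  have [r fr _] := XMp_fin fX (lt_trans ftc (ltry _)).
  have r0 : 0 < r by rewrite -lte_fin -fr em_gt0.
  move: ftc; rewrite fr lte_fin => rc.
  have cr : 1 < c / r by rewrite ltr_pdivlMr// mul1r.
  have t1 : 0 < `|t| + 1 by have := normr_ge0 t; lra.
  have l0 : 0 < ln (c / r) by rewrite ln_gt0.
  pose d := ln (c / r) / (`|t| + 1); have d0 : 0 < d by rewrite divr_gt0.
  exists d => // y h; exists t; first by rewrite subrr normr0.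
  apply: (le_lt_trans (em_close _ h)); rewrite fr -EFinM lte_fin -ltr_pdivlMr//.
  rewrite -[ltRHS]lnK ?posrE ?divr_gt0//; last by lra.
  rewrite ltr_expR /d mulrA ltr_pdivrMr// mulrC ltr_pM2l//; lra.
move=> p q d fd; have [fl _] := fX.
have [e e0 fe] := elsc_itv_slack fl fd.
have [d0|d0] := ltP d 0.
  by exists 1 => // y _ t _; rewrite (lt_trans _ (em_gt0 y n t))// lte_fin.
pose K := (`|p| + `|q| + 1) * (d + e).
have p0 := normr_ge0 p; have q0 := normr_ge0 q.
have K0 : 0 < K by rewrite /K mulr_gt0//; lra.
(* The choice s K < e keeps exp(-|t| s) (d + e) above d on the whole segment, through exp(-x) >= 1 -
   x and a bound on |t|. *)
have [s /andP[s0 s1] [sK _]] := inf_exists_small e0 e0 K0.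
exists s => // y h t /andP[pt tq].
have h' i : (i < n.+1)%N -> `|x i - y i| < s by move=> ii; rewrite distrC h.
have tb : `|t| <= `|p| + `|q| + 1.
  have := ler_norm (- p); have := ler_norm q; rewrite normrN => ? ?.
  rewrite ler_norml; apply/andP; split; lra.
have [r E] : exists r, em y n.+1 t = r%:E by eexists; reflexivity.
have := em_close t h'; rewrite E.
have r0 : 0 < r by rewrite -lte_fin -E em_gt0.
have : ((d + e)%:E < em x n.+1 t)%E by apply: fe; apply/andP; split; lra.
move=> /lt_le_trans /[apply]; rewrite -EFinM !lte_fin => der.
have : expR (- (`|t| * s)) * (d + e) < r.
  rewrite -(ltr_pM2l (expR_gt0 (`|t| * s))) mulrA -expRD subrr expR0 mul1r.
  exact: der.
apply: le_lt_trans.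
apply: (@le_trans _ _ ((1 - `|t| * s) * (d + e))); last first.
  by rewrite ler_wpM2r//; [lra | have := expR_ge1Dx (- (`|t| * s)); lra].
have : `|t| * s * (d + e) <= s * K.
  rewrite /K [s * _]mulrCA -mulrA ler_wpM2r//; last by rewrite mulr_ge0//; lra.
rewrite /K in sK *; lra.
Qed.

Definition tup n (x : nat -> R) : n.-tuple R := [tuple x i | i < n].

Definition emset (G : set (efun R)) n : set (n.-tuple R) :=
  [set u | G (em (nth 0 u) n)].
Arguments emset : clear implicits.

Lemma emset_tup G n x : emset G n (tup n x) <-> G (em x n).
Proof.
rewrite /emset /=; have -> // : em (nth 0 (tup n x)) n = em x n.
apply: em_eq => i iln; rewrite (_ : nth 0 (tup n x) i = tnth (tup n x) (Ordinal iln)).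
  by rewrite tnth_mktuple.
by rewrite (tnth_nth 0).
Qed.

(** Measurability is read off in the finite-dimensional sample space: the preimage of an open set is
    open there, hence a countable union of the rational cubes it contains. *)
Lemma measurable_emset (G : set (efun R)) n : AWopen (XM R) G ->
  measurable (emset G n).
Proof.
move=> Go; case: n => [|n].
  rewrite (_ : emset G 0 = set0) //; apply/seteqP; split => // u /=.
  by move=> /(proj1 Go) /em0_notXM.
pose B (p : n.+1.-tuple rat * rat) : set (n.+1.-tuple R) :=
  \bigcap_(i in [set: 'I_n.+1]) [set u | `|tnth u i - ratr (tnth p.1 i)| < ratr p.2].
have mB p : measurable (B p).
  apply: fin_bigcap_measurable => // i _.
  have -> : [set u : n.+1.-tuple R | `|tnth u i - ratr (tnth p.1 i)| < ratr p.2] =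
     (@tnth n.+1 R ^~ i) @^-1` (ball (ratr (tnth p.1 i) : R) (ratr p.2)).
    by apply/seteqP; split => u; rewrite /ball /= distrC.
  rewrite -[X in measurable X]setTI; apply: measurable_tnth => //.
  exact: measurable_ball.
pose C (p : n.+1.-tuple rat * rat) := if pselect (B p `<=` emset G n.+1) then B p else set0.
have -> : emset G n.+1 = \bigcup_p C p.
  apply/seteqP; split => u; last by move=> [p _]; rewrite /C; case: pselect => // h /h.
  move=> uG; have [d d0 dG] := AWopen_em_nbhs Go uG.
  have d42 : d / 4 < d / 2 by lra.
  have [q] := rat_in_itvoo d42.
  rewrite in_itv /= => /andP[q1 q2].
  have /choice[r rP] : forall i : 'I_n.+1, exists r : rat, `|tnth u i - ratr r| < d / 4.
    move=> i; have ui : tnth u i - d / 4 < tnth u i + d / 4 by lra.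
    have [r] := rat_in_itvoo ui.
    by rewrite in_itv /= => /andP[? ?]; exists r; rewrite ltr_norml; apply/andP; split; lra.
  exists ([tuple r i | i < n.+1], q) => //; rewrite /C; case: pselect => [h|[]].
    by move=> i _ /=; rewrite tnth_mktuple (lt_trans (rP i)).
  move=> v Bv; apply: dG => i iln.
  have := Bv (Ordinal iln) I; rewrite /= tnth_mktuple => h1.
  have := rP (Ordinal iln) => h2.
  rewrite -!(tnth_nth 0 _ (Ordinal iln)).
  rewrite (le_lt_trans (ler_distD (ratr (r (Ordinal iln))) _ _))//.
  by rewrite (distrC (ratr _)); lra.
apply: countable_bigcupT_measurable.
  exact: countableP.
by move=> p; rewrite /C; case: pselect => h; [exact: mB | exact: measurable0].
Qed.

End Empirical.
Arguments emset {R} G n _.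

(** * Independence of successive blocks of variables *)

Section Independence.
Variables (R : realType) (d : measure_display) (T : measurableType d).
Variables (P : probability T R) (mu : probability R R) (X : nat -> T -> R).
Hypothesis iidX : iid_seq P mu X.

Let mX i : measurable_fun setT (X i). Proof. by case: iidX. Qed.

Lemma measurable_preimX i (B : set R) : measurable B -> measurable (X i @^-1` B).
Proof. by move=> mB; rewrite -[X in measurable X]setTI; exact: mX. Qed.

Definition rect n (B : nat -> set R) : set (n.-tuple R) :=
  [set u | forall i : 'I_n, B i (tnth u i)].
Arguments rect : clear implicits.

Lemma measurable_tuple_rect n :
  @measurable _ (n.-tuple R) = <<s [set A | exists2 B, (forall i, measurable (B i)) & A = rect n B] >>.
Proof.
apply/seteqP; split.
- apply: smallest_sub; first exact: smallest_sigma_algebra.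
  rewrite -bigcup_seq => A [i _ [Y mY <-]]; apply: sub_sigma_algebra.
  exists (fun k => if k == i :> nat then Y else setT); first by move=> k; case: ifP.
  rewrite setTI; apply/seteqP; split => u /=.
    by move=> uY k; case: ifPn => // /eqP /val_inj ->.
  by move=> /(_ i); rewrite eqxx.
- apply: smallest_sub; first exact: sigma_algebra_measurable.
  move=> _ [B mB ->].
  have -> : rect n B = \bigcap_(i in [set: 'I_n]) ((@tnth n R ^~ i) @^-1` (B i)).
    by apply/seteqP; split => u uB i; [move=> _; exact: uB | exact: uB i I].
  apply: fin_bigcap_measurable => // i _.
  by rewrite -[X in measurable X]setTI; exact: measurable_tnth.
Qed.

(** Both sides are finite measures in A with the same total mass c, so agreement on the pi-system of
    rectangles suffices. [H] stands for a past event and [Y0] for a reference block: independence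
    and equality of laws come together. *)
Lemma tuple_law n (Y Y0 : T -> n.-tuple R) (H : set T) (c : R) :
  measurable_fun setT Y -> measurable_fun setT Y0 -> measurable H -> P H = c%:E ->
  (forall B, (forall i, measurable (B i)) ->
    P (H `&` Y @^-1` rect n B) = (c%:E * P (Y0 @^-1` rect n B))%E) ->
  forall A, measurable A -> P (H `&` Y @^-1` A) = (c%:E * P (Y0 @^-1` A))%E.
Proof.
move=> mY mY0 mH PH HB A; rewrite measurable_tuple_rect.
have mYA S : measurable S -> measurable (Y @^-1` S).
  by move=> mS; rewrite -[X in measurable X]setTI; exact: mY.
have mY0A S : measurable S -> measurable (Y0 @^-1` S).
  by move=> mS; rewrite -[X in measurable X]setTI; exact: mY0.
move: A; apply: (@dynkin_induction _ (n.-tuple R) _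
  (fun A => P (H `&` Y @^-1` A) = (c%:E * P (Y0 @^-1` A))%E)).
- exact: measurable_tuple_rect.
- move=> _ _ [B mB ->] [C mC ->]; exists (fun i => B i `&` C i).
    by move=> i; exact: measurableI.
  apply/seteqP; split => u /=; first by move=> [uB uC] i; split.
  by move=> h; split=> i; case: (h i).
- by rewrite !preimage_setT setIT probability_setT mule1.
- by move=> _ [B mB ->]; exact: HB.
- move=> S mS IH.
  have e1 : P (H `\` Y @^-1` S) = (P H - P (H `&` Y @^-1` S))%E.
    by apply: measureD; [| exact: mYA | apply: (le_lt_trans (probability_le1 _ _)); rewrite ?ltry].
  have e2 : P (~` (Y0 @^-1` S)) = (1 - P (Y0 @^-1` S))%E.
    by apply: probability_setC; exact: mY0A.
  rewrite -[LHS]/(P (H `\` Y @^-1` S)) -[X in (_ * X)%E]/(P (~` (Y0 @^-1` S))) e1 e2 IH PH.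
  have : P (Y0 @^-1` S) \is a fin_num by rewrite fin_num_measure//; exact: mY0A.
  by move=> /fineK <-; rewrite -EFinM -!EFinB -EFinM mulrBr mulr1.
- move=> F mF tF IH.
  have mYF k : measurable (H `&` Y @^-1` F k) by apply: measurableI => //; exact: mYA.
  have c0 : (0 <= c%:E)%E by rewrite -PH.
  have e1 : P (\bigcup_k (H `&` Y @^-1` F k)) = (\sum_(0 <= k <oo) P (H `&` Y @^-1` F k))%E.
    apply: measure_semi_bigcup => //; last exact: bigcup_measurable.
    apply/trivIsetP => i j _ _ ij; move/trivIsetP : tF => /(_ i j I I ij) FF.
    rewrite -subset0 => w [[_ wi] [_ wj]].
    by have : set0 (Y w) by rewrite -FF; split.
  have e2 : P (\bigcup_k (Y0 @^-1` F k)) = (\sum_(0 <= k <oo) P (Y0 @^-1` F k))%E.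
    apply: measure_semi_bigcup => //.
    - by move=> k; exact: mY0A.
    - apply/trivIsetP => i j _ _ ij; move/trivIsetP : tF => /(_ i j I I ij) FF.
      rewrite -subset0 => w [wi wj].
      by have : set0 (Y0 w) by rewrite -FF; split.
    - by apply: bigcup_measurable => k _; exact: mY0A.
  rewrite !preimage_bigcup setI_bigcupr e1 e2 -nneseriesZl//.
  by apply: eq_eseriesr => k _; exact: IH.
Qed.

Definition block m n (w : T) : n.-tuple R := tup n (fun i => X (m + i) w).
Arguments block : clear implicits.

Lemma measurable_block m n : measurable_fun setT (block m n).
Proof.
apply/measurable_fun_tnthP => i.
rewrite (_ : _ \o _ = X (m + i)); first exact: mX.
by apply/funext => w; rewrite /= tnth_mktuple.
Qed.

Lemma block_rect m n B : block m n @^-1` rect n B =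
  \bigcap_(j in [set` iota m n]) (X j @^-1` B (j - m)%N).
Proof.
apply/seteqP; split => w.
  move=> wB j /=; rewrite mem_iota => /andP[mj jmn].
  have jn : (j - m < n)%N by rewrite ltn_subLR.
  have := wB (Ordinal jn); rewrite /= tnth_mktuple /= subnKC//.
move=> h i; rewrite tnth_mktuple; have := h (m + i)%N; rewrite addKn; apply.
by rewrite /= mem_iota leq_addr ltn_add2l ltn_ord.
Qed.

Lemma prob_block_rect m n B : (forall i, measurable (B i)) ->
  P (block m n @^-1` rect n B) = (\prod_(i <- iota 0 n) mu (B i))%E.
Proof.
move=> mB; have [_ [idX indX]] := iidX.
rewrite block_rect (indX _ (fun j => B (j - m)%N)) ?iota_uniq//.
rewrite -[m in iota m n]addn0 iotaDl big_map; apply: eq_bigr => i _.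
by rewrite addKn idX.
Qed.

(* Independence of the variables from time m on, for events expressed by earlier variables. *)
Definition past m (E : set T) := measurable E /\
  forall s B, uniq s -> {in s, forall i, (m <= i)%N} -> (forall i, measurable (B i)) ->
    P (E `&` \bigcap_(i in [set` s]) (X i @^-1` B i)) = (P E * \prod_(i <- s) mu (B i))%E.

Lemma past0 : past 0 setT.
Proof.
split => // s B us _ mB; rewrite setTI probability_setT mul1e.
have [_ [idX indX]] := iidX; rewrite indX//.
by apply: eq_bigr => i _; rewrite idX.
Qed.

Lemma prodmu_fin (s : seq nat) B : (forall i, measurable (B i)) ->
  (\prod_(i <- s) mu (B i))%E = (\prod_(i <- s) fine (mu (B i)))%:E.
Proof.
move=> mB; elim: s => [|i s IH]; first by rewrite !big_nil.
by rewrite !big_cons IH EFinM fineK// fin_num_measure.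
Qed.

Lemma past_block m n E (A : set (n.-tuple R)) : past m E -> measurable A ->
  past (m + n) (E `&` block m n @^-1` A) /\
  P (E `&` block m n @^-1` A) = (P E * P (block 0 n @^-1` A))%E.
Proof.
move=> [mE indE] mA.
have mblk k : measurable (block k n @^-1` A).
  by rewrite -[X in measurable X]setTI; exact: measurable_block.
(* Later coordinates are put into the event [H] of [tuple_law]. With an empty s this gives the
   probability, in general the independence from the future. *)
have key s B : uniq s -> {in s, forall i, (m + n <= i)%N} -> (forall i, measurable (B i)) ->
    P ((E `&` \bigcap_(i in [set` s]) (X i @^-1` B i)) `&` block m n @^-1` A) =
    (P E * \prod_(i <- s) mu (B i) * P (block 0 n @^-1` A))%E.
  move=> us sm mB.
  have sm' : {in s, forall i, (m <= i)%N}.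
    by move=> i /sm; apply: leq_trans; exact: leq_addr.
  pose c := fine (P E) * \prod_(i <- s) fine (mu (B i)).
  have cE : (P E * \prod_(i <- s) mu (B i))%E = c%:E.
    by rewrite prodmu_fin// /c EFinM fineK// fin_num_measure.
  rewrite cE; apply: tuple_law => //.
  - exact: measurable_block.
  - exact: measurable_block.
  - apply: measurableI => //; apply: fin_bigcap_measurable => // i _.
    exact: measurable_preimX.
  - by rewrite indE.
  move=> C mC; rewrite block_rect -setIA prob_block_rect// -cE -muleA.
  pose D j := if j \in s then B j else C (j - m)%N.
  have sD : [set` s] `|` [set` iota m n] = [set` (s ++ iota m n)].
    by apply/seteqP; split => i /=; rewrite mem_cat => /orP.
  have ns i : i \in iota m n -> i \notin s.
    rewrite mem_iota => /andP[_ imn]; apply/negP => /sm; by rewrite leqNgt imn.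
  have -> : (\bigcap_(i in [set` s]) (X i @^-1` B i)) `&`
     (\bigcap_(j in [set` iota m n]) (X j @^-1` C (j - m)%N)) =
     \bigcap_(i in [set` (s ++ iota m n)]) (X i @^-1` D i).
    rewrite -sD bigcap_setU; congr (_ `&` _); apply: eq_bigcapr => i /= ii.
      by rewrite /D ii.
    by rewrite /D (negbTE (ns _ ii)).
  rewrite indE.
  - rewrite big_cat /=; congr (_ * (_ * _))%E.
      by rewrite !big_seq; apply: eq_bigr => i ii; rewrite /D ii.
    rewrite -[m in iota m n]addn0 iotaDl big_map big_seq [RHS]big_seq.
    apply: eq_bigr => i ii; rewrite /D addKn ifN//; apply: ns.
    by rewrite -[m in iota m n]addn0 iotaDl map_f.
  - rewrite cat_uniq us iota_uniq /= andbT; apply/hasPn => i; exact: ns.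
  - move=> i; rewrite mem_cat => /orP[/sm'//|]; by rewrite mem_iota => /andP[].
  - by move=> i; rewrite /D; case: ifP.
have PE : P (E `&` block m n @^-1` A) = (P E * P (block 0 n @^-1` A))%E.
  have := key [::] (fun=> setT) isT; rewrite big_nil mule1 => <- //.
  rewrite (_ : \bigcap_(i in _) _ = setT) ?setIT//.
  by apply/seteqP; split => // w _ i.
split => //; split; first exact: measurableI.
move=> s B us sm mB; rewrite setIAC key// PE -!muleA; congr (_ * _)%E.
by rewrite muleC.
Qed.

Fixpoint blocks n (A : set (n.-tuple R)) q : set T :=
  if q is q'.+1 then blocks A q' `&` block (q' * n) n @^-1` A else setT.

Lemma past_blocks n (A : set (n.-tuple R)) q : measurable A ->
  past (q * n) (blocks A q) /\
  P (blocks A q) = ((fine (P (block 0 n @^-1` A))) ^+ q)%:E.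
Proof.
move=> mA; elim: q => [|q [pq Pq]] /=; first by rewrite probability_setT; split => //; exact: past0.
have [h1 h2] := past_block pq mA; rewrite mulSn addnC; split => //.
rewrite h2 Pq exprSr EFinM fineK// fin_num_measure//.
by rewrite -[X in measurable X]setTI; exact: measurable_block.
Qed.

Lemma blocksP n (A : set (n.-tuple R)) q w : blocks A q w ->
  forall j, (j < q)%N -> A (block (j * n) n w).
Proof.
elim: q => // q IH [/IH h1 h2] j; rewrite ltnS leq_eqVlt => /orP[/eqP -> //|].
exact: h1.
Qed.

Lemma prob_blocks_rest n (A : set (n.-tuple R)) q r (B : set R) :
  measurable A -> measurable B ->
  P (blocks A q `&` \bigcap_(i in [set` iota (q * n) r]) (X i @^-1` B)) =
  (fine (P (block 0 n @^-1` A)) ^+ q * fine (mu B) ^+ r)%:E.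
Proof.
move=> mA mB; have [[_ h] Pq] := past_blocks q mA.
rewrite (h _ (fun=> B)) ?iota_uniq//; last first.
  by move=> i; rewrite mem_iota => /andP[].
rewrite Pq prodmu_fin// -EFinM; congr (_ * _)%:E.
by rewrite big_const_seq count_predT size_iota iter_mulr_1.
Qed.

End Independence.

(** * Averages of blocks whose transforms are near [f] stay near [f] *)

Section LocalConvexity.
Variable R : realType.
Implicit Types (f g : efun R) (x : nat -> R).

Definition emr x (n : nat) (t : R) : R := n%:R^-1 * \sum_(i < n) expR (t * x i).
Definition shift (m : nat) x : nat -> R := fun i => x (m + i)%N.

Lemma emE x n t : em x n t = (emr x n t)%:E. Proof. by []. Qed.

Lemma emr_gt0 x n t : (0 < n)%N -> 0 < emr x n t.
Proof. by case: n => // n _; rewrite -lte_fin -emE em_gt0. Qed.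

Lemma sum_shift (h : nat -> R) m n :
  \sum_(i < m + n) h i = \sum_(i < m) h i + \sum_(i < n) h (m + i)%N.
Proof. by rewrite big_split_ord. Qed.

Lemma sum_blocks (h : nat -> R) N q :
  \sum_(i < q * N) h i = \sum_(j < q) \sum_(i < N) h (j * N + i)%N.
Proof.
elim: q => [|q IH]; first by rewrite mul0n !big_ord0.
by rewrite mulSnr sum_shift IH big_ord_recr.
Qed.

Lemma emr_mul x n t : (0 < n)%N -> n%:R * emr x n t = \sum_(i < n) expR (t * x i).
Proof. by move=> n0; rewrite /emr mulrA divff ?mul1r// pnatr_eq0 -lt0n. Qed.

Lemma emr_blocks x N q r t : (0 < N)%N -> (0 < q)%N ->
  (q * N + r)%:R * emr x (q * N + r) t =
  N%:R * (\sum_(j < q) emr (shift (j * N) x) N t) + \sum_(i < r) expR (t * x (q * N + i)%N).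
Proof.
move=> N0 q0; rewrite emr_mul ?addn_gt0 ?muln_gt0 ?q0 ?N0//.
rewrite (sum_shift (fun i => expR (t * x i))) (sum_blocks (fun i => expR (t * x i))); congr (_ + _).
by rewrite mulr_sumr; apply: eq_bigr => j _; rewrite emr_mul.
Qed.

(* G absorbs block averages: long concatenations of blocks whose transforms are near f,
   completed by a short bounded remainder, have their transform in G. *)
Definition absorbs f (G : set (efun R)) := exists2 k, (0 < k)%N &
  forall (N : nat) (C : R), (0 < N)%N -> exists q0, forall q r x, (q0 <= q)%N -> (r < N)%N ->
    (forall j, (j < q)%N -> Vk k f (em (shift (j * N) x) N)) ->
    (forall i, (i < r)%N -> `|x (q * N + i)%N| <= C) ->
    G (em x (q * N + r)).

(** As a filter, absorption falls under [hit_miss_Vk] and has to be checked on hits and misses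
    only. *)
Lemma absorbs_filter f : XMp R f -> Filter (absorbs f).
Proof.
move=> fX; split.
- by exists 1%N => // N C N0; exists 0%N.
- move=> A B [k k0 kA] [l l0 lB]; exists (maxn k l); first by rewrite leq_max k0.
  move=> N C N0; have [qa qaP] := kA N C N0; have [qb qbP] := lB N C N0.
  exists (maxn qa qb) => q r x; rewrite geq_max => /andP[qaq qbq] rN h1 h2.
  have emX j : XMp R (em (shift (j * N) x) N).
    by case: N N0 {qaP qbP rN h1 h2} => // N _; case: (em_XM (shift (j * N.+1) x) N).
  split; [apply: qaP|apply: qbP] => // j jq.
    exact: (Vk_le k0 (leq_maxl _ _) fX (emX j) (h1 j jq)).
  exact: (Vk_le l0 (leq_maxr _ _) fX (emX j) (h1 j jq)).
- move=> A B AB [k k0 kA]; exists k => // N C N0; have [q0 h] := kA N C N0.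
  by exists q0 => q r x h1 h2 h3 h4; apply: AB; exact: h.
Qed.

(** Misses survive averaging directly, but the blocks may hit at different abscissae. Moving t
    slightly towards 0 reaches an interior point t' of the domain, where [Vk_upper] bounds all
    blocks at the same place; at t = 0 all values are 1. *)
Lemma absorbs_Vk f k : XM R f -> (0 < k)%N -> absorbs f (Vk k f).
Proof.
move=> fXM k0; have [fX _] := fXM; have FF := absorbs_filter fX.
have pos N q r : (0 < N)%N -> (1 <= q)%N -> (0 < q * N + r)%N.
  by move=> N0 q0; rewrite addn_gt0 muln_gt0 q0 N0.
have emX x n : (0 < n)%N -> XM R (em x n) by case: n => // n _; exact: em_XM.
apply: (hit_miss_Vk FF _ fX) => //.
- exists 1%N => // N C N0; exists 1%N => q r x q1 _ _ _.
  by have [] := emX x _ (pos N q r N0 q1).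
- move=> t c e ftc e0.
  have [t0|t0] := eqVneq t 0.
    exists 1%N => // N C N0; exists 1%N => q r x q1 _ _ _; exists 0.
      by rewrite t0 subrr normr0.
    by rewrite (XM0 (emX x _ (pos N q r N0 q1))) -(XM0 fXM) -t0.
  have fty := lt_trans ftc (ltry _).
  have [rt ftr rt0] := XMp_fin fX fty.
  move: ftc; rewrite ftr lte_fin => rc.
  pose M := `|t| + 2; have M0 : 0 < M by rewrite /M; have := normr_ge0 t; lra.
  have rc0 : 0 < c - rt by rewrite subr_gt0.
  (* The constant M covers both the displacement s |t| and the cost s of the value f(0) = 1 in the
     convexity bound at t'. *)
  have [s /andP[s0 s1] [se sc]] := inf_exists_small e0 rc0 M0.
  pose t' := (1 - s) * t.
  have f0 : f 0 = 1%E by exact: XM0.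
  have ft' : (f t' < c%:E)%E.
    have [_ [fc _]] := fX; have s01 : 0 <= s <= 1 by rewrite !ltW.
    have := fc 0 t s s01; rewrite mulr0 add0r f0 ftr mule1 -EFinM -EFinD.
    move=> /le_lt_trans; apply; rewrite lte_fin.
    have : s * 2 <= s * M by rewrite ler_wpM2l ?(ltW s0)// /M; have := normr_ge0 t; lra.
    have : 0 <= s * rt by rewrite mulr_ge0// ltW.
    lra.
  have t't : `|t' - t| < e.
    have -> : t' - t = - (s * t) by rewrite /t'; ring.
    rewrite normrN normrM gtr0_norm//; apply: le_lt_trans se.
    by rewrite ler_wpM2l ?(ltW s0)// /M; lra.
  have [r' ft'r r'0] := XMp_fin fX (lt_trans ft' (ltry _)).
  move: ft'; rewrite ft'r lte_fin => r'c.
  pose c' := (r' + c) / 2.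
  have fc' : (f t' < c'%:E)%E by rewrite ft'r lte_fin /c'; lra.
  have f0y : (f 0%R < +oo)%E by rewrite f0 ltry.
  have [l l0 lP] : exists2 l, (0 < l)%N & forall g, XMp R g -> Vk l f g -> (g t' < c'%:E)%E.
    have [tp|tn] := ltP 0 t.
      apply: (@Vk_upper _ f 0 t' t) => //; rewrite /t'; apply/andP; split.
        by rewrite mulr_gt0// subr_gt0.
      have : 0 < s * t by rewrite mulr_gt0.
      by lra.
    have {}tn : t < 0 by rewrite lt_neqAle t0.
    apply: (@Vk_upper _ f t t' 0) => //; rewrite /t'; apply/andP; split.
      have : s * t < 0 by rewrite pmulr_rlt0.
      by lra.
    by rewrite pmulr_rlt0// subr_gt0.
  exists l => // N C N0.
  pose E := expR (`|t'| * C).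
  have cc' : 0 < c - c' by rewrite /c'; lra.
  (* The remainder adds at most N E to the sum, while the q full blocks leave a margin of N q (c -
     c'). *)
  pose q0 := (Num.truncn (E / (c - c'))).+1.
  exists q0 => q r x qq rN h1 h2; exists t' => //.
  have q1 : (0 < q)%N by exact: leq_trans qq.
  have n0 := pos N q r N0 q1.
  rewrite emE lte_fin -(@ltr_pM2l _ (q * N + r)%:R) ?ltr0n//.
  rewrite emr_blocks//.
  have S1 : \sum_(j < q) emr (shift (j * N) x) N t' <= q%:R * c'.
    rewrite mulr_natl -[q in _ *+ q]card_ord -sumr_const; apply: ler_sum => j _.
    by rewrite -lee_fin -emE ltW// lP//; [case: (emX (shift (j * N) x) N N0) | exact: h1].
  have S2 : \sum_(i < r) expR (t' * x (q * N + i)%N) <= r%:R * E.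
    rewrite mulr_natl -[r in _ *+ r]card_ord -sumr_const; apply: ler_sum => i _.
    rewrite ler_expR (le_trans (ler_norm _))// normrM ler_wpM2l// h2//.
  have rN' : r%:R * E <= N%:R * E by rewrite ler_wpM2r ?expR_ge0// ler_nat ltnW.
  have qE : E < q%:R * (c - c').
    rewrite -ltr_pdivrMr// (lt_le_trans (truncnS_gt _))// ler_nat//.
  have Np : 0 < N%:R :> R by rewrite ltr0n.
  have h3 : N%:R * E < N%:R * (q%:R * (c - c')) by rewrite ltr_pM2l.
  have h4 : N%:R * (\sum_(j < q) emr (shift (j * N) x) N t') <= N%:R * (q%:R * c').
    by rewrite ler_pM2l.
  have h5 : 0 <= r%:R * c by rewrite mulr_ge0 ?ler0n//; lra.
  rewrite natrD natrM; lra.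
move=> p q' d fd; have [fl _] := fX.
have [e e0 fe] := elsc_itv_slack fl fd.
have [l l0 lP] : exists2 l, (0 < l)%N & forall g, XMp R g -> Vk l f g ->
    forall t, p <= t <= q' -> ((d + e)%:E < g t)%E.
  by apply: Vk_miss => // t /andP[? ?]; apply: fe; apply/andP; split; lra.
exists l => // N C N0.
have [d0|d0] := ltP d 0.
  exists 1%N => q r x q1 _ _ _ t _; rewrite emE lte_fin (lt_trans d0)//.
  by apply: emr_gt0; exact: pos.
(* The remainder terms are nonnegative but enlarge the sample size; the demand r d <= N d is met by
   the margin N q e of the blocks. *)
exists (Num.truncn (d / e)).+1 => q r x qq rN h1 _ t tpq.
have q1 : (0 < q)%N by exact: leq_trans qq.
have n0 := pos N q r N0 q1.
rewrite emE lte_fin -(@ltr_pM2l _ (q * N + r)%:R) ?ltr0n// emr_blocks//.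
have S1 : q%:R * (d + e) <= \sum_(j < q) emr (shift (j * N) x) N t.
  rewrite mulr_natl -[q in _ *+ q]card_ord -sumr_const; apply: ler_sum => j _.
  by rewrite -lee_fin -emE ltW// lP//; [case: (emX (shift (j * N) x) N N0) | exact: h1].
have S2 : 0 <= \sum_(i < r) expR (t * x (q * N + i)%N).
  by apply: sumr_ge0 => i _; exact: expR_ge0.
have qd : d < q%:R * e.
  by rewrite -ltr_pdivrMr// (lt_le_trans (truncnS_gt _))// ler_nat.
have Np : 0 < N%:R :> R by rewrite ltr0n.
have h3 : N%:R * d < N%:R * (q%:R * e) by rewrite ltr_pM2l.
have h4 : N%:R * (q%:R * (d + e)) <= N%:R * (\sum_(j < q) emr (shift (j * N) x) N t).
  by rewrite ler_pM2l.
have h5 : r%:R * d <= N%:R * d by rewrite ler_wpM2r// ler_nat ltnW.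
rewrite natrD natrM; lra.
Qed.

End LocalConvexity.

Section LimSup.
Variable R : realType.
Implicit Types (u : nat -> \bar R) (a : \bar R).
Local Open Scope ereal_scope.

Lemma limn_einf_ge u a : (\forall n \near \oo, a <= u n) -> a <= limn_einf u.
Proof.
move=> [N _ h]; rewrite limn_einf_lim; apply: lime_ge; first exact: is_cvg_einfs.
exists N => // n /= Nn; apply: le_ereal_inf_tmp => _ [m /= nm <-].
by apply: h => /=; exact: leq_trans nm.
Qed.

Lemma limn_esup_le u a : (\forall n \near \oo, u n <= a) -> limn_esup u <= a.
Proof.
move=> [N _ h]; rewrite limn_esup_lim; apply: lime_le; first exact: is_cvg_esups.
exists N => // n /= Nn; apply: ge_ereal_sup => _ [m /= nm <-].
by apply: h => /=; exact: leq_trans nm.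
Qed.

Lemma limn_esup_lt u a : limn_esup u < a -> \forall n \near \oo, u n < a.
Proof.
rewrite limn_esup_lim (cvg_lim _ (@cvg_esups_inf _ u))//.
move=> /ereal_inf_lt[_ [N _ <-] h]; exists N => // n /= Nn.
by apply: le_lt_trans h; apply: ereal_sup_ubound; exists n.
Qed.

End LimSup.

(** * Exponential rates: superadditivity, and decay near points outside [XM] *)

Section Rates.
Variables (R : realType) (d : measure_display) (T : measurableType d).
Variables (P : probability T R) (mu : probability R R) (X : nat -> T -> R).
Hypothesis iidX : iid_seq P mu X.
Implicit Types (f g : efun R) (G : set (efun R)).

Definition pr G n : R := fine (P [set w | G (Mn X n w)]).

Lemma pr_ge0 G n : 0 <= pr G n.
Proof. by apply: fine_ge0; exact: measure_ge0. Qed.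

Lemma block0_emset G n : block X 0 n @^-1` emset G n = [set w | G (Mn X n w)].
Proof.
apply/funext => w; apply/propext; exact: (emset_tup G n (fun i => X i w)).
Qed.

Lemma measurable_event G n : AWopen (XM R) G -> measurable [set w | G (Mn X n w)].
Proof.
move=> Go; rewrite -block0_emset -[X in measurable X]setTI.
apply: (measurable_block iidX) => //; exact: measurable_emset.
Qed.

Lemma Mn_XM n w : (0 < n)%N -> XM R (Mn X n w).
Proof. by case: n => // n _; exact: (em_XM (fun i => X i w)). Qed.

Lemma prE G n : measurable [set w | G (Mn X n w)] -> P [set w | G (Mn X n w)] = (pr G n)%:E.
Proof. by move=> mG; rewrite /pr fineK// fin_num_measure. Qed.

Lemma pr_le G H n : measurable [set w | G (Mn X n w)] -> measurable [set w | H (Mn X n w)] ->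
  (forall w, G (Mn X n w) -> H (Mn X n w)) -> pr G n <= pr H n.
Proof.
move=> mG mH GH; rewrite -lee_fin -!prE//; apply: le_measure; rewrite ?inE//.
Qed.

Lemma pr_le1 G n : measurable [set w | G (Mn X n w)] -> pr G n <= 1.
Proof. by move=> mG; rewrite -lee_fin -prE// probability_le1. Qed.

Lemma lprob_le G n (a : R) : (0 < n)%N ->
  (lprob P X G n <= a%:E)%E = (pr G n <= expR (n%:R * a)).
Proof.
move=> n0; have n0' : 0 < n%:R :> R by rewrite ltr0n.
rewrite /lprob -/(pr G n) /elog; case: eqP => [->|/eqP pn0].
  by rewrite gt0_muleNy ?lte_fin ?invr_gt0// leNye expR_ge0.
have pp : 0 < pr G n by rewrite lt_def pn0 pr_ge0.
by rewrite -EFinM lee_fin ler_pdivrMl// -[in RHS](lnK pp) ler_expR.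
Qed.

Lemma lprob_ge G n (a : R) : (0 < n)%N ->
  (a%:E <= lprob P X G n)%E = (expR (n%:R * a) <= pr G n).
Proof.
move=> n0; have n0' : 0 < n%:R :> R by rewrite ltr0n.
rewrite /lprob -/(pr G n) /elog; case: eqP => [->|/eqP pn0].
  by rewrite gt0_muleNy ?lte_fin ?invr_gt0// leeNy_eq /= leNgt expR_gt0.
have pp : 0 < pr G n by rewrite lt_def pn0 pr_ge0.
by rewrite -EFinM lee_fin ler_pdivlMl// -[in RHS](lnK pp) ler_expR.
Qed.

(* Ruelle-Lanford superadditivity: independent blocks whose transforms are near f average into G. *)
Lemma lprob_superadditive f G : XM R f -> AWopen (XM R) G -> G f ->
  exists2 k, (0 < k)%N & forall N, (0 < N)%N ->
    (lprob P X (Vk k f `&` XM R) N <= limn_einf (lprob P X G))%E.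
Proof.
move=> fXM Go Gf; have [fX _] := fXM.
have [_ /(_ f Gf)[k0 [k00 kG]]] := Go.
have [k kp kabs] := absorbs_Vk fXM k00.
exists k => // N N0; set G' := Vk k f `&` XM R.
have G'o : AWopen (XM R) G' by exact: AWopen_Vk.
have mE n := measurable_event n Go.
have mE' n := measurable_event n G'o.
have [p0|pn0] := eqVneq (pr G' N) 0.
  by rewrite /lprob -/(pr G' N) p0 /elog eqxx gt0_muleNy ?lte_fin ?invr_gt0 ?ltr0n// leNye.
set p := pr G' N; have pp : 0 < p by rewrite lt_def pn0 pr_ge0.
have p1 : p <= 1 by exact: pr_le1.
(* The fewer than N leftover variables are confined to an interval of positive mass b. This costs at
   most a factor b^N, which disappears on the exponential scale. *)
have [C C0 mC] : exists2 C, 0 < C & (0 < mu `[(- C)%R, C]%classic)%E.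
  have : (0 < lap mu 0%R)%E by rewrite -mgfE mgf0 lte_fin.
  by move=> /lapT_gt[C C0]; rewrite lapT0; exists C.
pose b := fine (mu `[(- C)%R, C]%classic).
have bE : mu `[(- C)%R, C]%classic = b%:E by rewrite /b fineK// fin_num_measure.
have b0 : 0 < b by rewrite -lte_fin -bE.
have b1 : b <= 1 by rewrite -lee_fin -bE probability_le1.
have [q0 qP] := kabs N C N0.
have low n : (0 < n)%N -> (q0 * N <= n)%N -> p ^+ (n %/ N) * b ^+ (n %% N) <= pr G n.
  move=> n0 qn; rewrite -lee_fin -prE//.
  have mA : measurable (emset G' N) by exact: measurable_emset.
  have := prob_blocks_rest iidX (n %/ N) (n %% N) mA (measurable_itv `[- C, C]).
  rewrite block0_emset -/(pr G' N) -/p -/b => <-.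
  apply: le_measure; rewrite ?inE//.
    apply: measurableI; first by have [[]] := past_blocks iidX (n %/ N) mA.
    apply: fin_bigcap_measurable => // i _; apply: (measurable_preimX iidX).
    exact: measurable_itv.
  move=> w [/blocksP wA wr].
  apply: kG; split; last exact: Mn_XM.
  have -> : Mn X n w = em (fun i => X i w) (n %/ N * N + n %% N) by rewrite -divn_eq.
  apply: qP.
  - by rewrite leq_divRL.
  - by rewrite ltn_mod.
  - by move=> j jq; have /emset_tup[] := wA j jq.
  - move=> i ir; have := wr (n %/ N * N + i)%N.
    rewrite /= mem_iota leq_addr ltn_add2l ir => /(_ isT).
    by rewrite in_itv /= -ler_norml.
have lnp : ln p <= 0 by rewrite -ln1 ler_ln ?posrE.
have lnb : ln b <= 0 by rewrite -ln1 ler_ln ?posrE.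
have -> : lprob P X G' N = (N%:R^-1 * ln p)%:E.
  by rewrite /lprob -/(pr G' N) -/p /elog (negbTE pn0).
apply/lee_addgt0Pr => e e0; rewrite -leeBlDr//; apply: limn_einf_ge.
pose M := N%:R * - ln b / e.
exists (maxn (q0 * N) (Num.truncn M).+1) => // n /=; rewrite geq_max => /andP[qn Mn'].
have n0 : (0 < n)%N by exact: leq_trans Mn'.
have n0' : 0 < n%:R :> R by rewrite ltr0n.
have N0' : 0 < N%:R :> R by rewrite ltr0n.
rewrite -EFinB lprob_ge//; apply: le_trans (low n n0 qn).
have h1 : p ^+ (n %/ N) = expR ((n %/ N)%:R * ln p).
  by rewrite expRM_natl lnK.
have h2 : b ^+ (n %% N) = expR ((n %% N)%:R * ln b).
  by rewrite expRM_natl lnK.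
rewrite h1 h2 -expRD ler_expR mulrBr.
have i1 : n%:R * (N%:R^-1 * ln p) <= (n %/ N)%:R * ln p.
  rewrite mulrA ler_wnM2r// ler_pdivlMr// -natrM ler_nat; exact: leq_trunc_div.
have i2 : N%:R * ln b <= (n %% N)%:R * ln b.
  by rewrite ler_wnM2r// ler_nat ltnW// ltn_mod.
have i3 : N%:R * - ln b <= n%:R * e.
  by rewrite -ler_pdivrMr// (le_trans (ltW (truncnS_gt _)))// ler_nat.
lra.
Qed.

Lemma measure_bigU_le (I : Type) (s : seq I) (Q : pred I) (A : I -> set T) (c : I -> R) :
  (forall i, measurable (A i)) -> (forall i, Q i -> (P (A i) <= (c i)%:E)%E) ->
  (P (\big[setU/set0]_(i <- s | Q i) A i) <= (\sum_(i <- s | Q i) c i)%:E)%E.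
Proof.
move=> mA Ac; elim: s => [|i s IH]; first by rewrite !big_nil measure0.
rewrite !big_cons; case: ifP => // Qi; rewrite EFinD.
apply: (@le_trans _ _ (P (A i) + P (\big[setU/set0]_(j <- s | Q j) A j))%E).
  by apply: measureU2 => //; exact: bigsetU_measurable.
by rewrite leeD// Ac.
Qed.

(* The union is the event that a fraction kappa of the first n variables falls in B. *)
Lemma tail_fraction (B : set R) (l kappa : R) n : measurable B ->
  0 <= l -> 0 <= kappa -> (mu B <= (expR (- l))%:E)%E ->
  (P (\big[setU/set0]_(J : {set 'I_n} | (kappa * n%:R <= #|J|%:R)%R)
     \bigcap_(i in [set` [seq nat_of_ord i | i <- enum J]]) (X i @^-1` B))
   <= (expR (n%:R * (1 - kappa * l)))%:E)%E.
Proof.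
move=> mB l0 k0 muB; have [_ [idX indX]] := iidX.
have mA (J : {set 'I_n}) : measurable
    (\bigcap_(i in [set` [seq nat_of_ord i | i <- enum J]]) (X i @^-1` B)).
  by apply: fin_bigcap_measurable => // i _; exact: (measurable_preimX iidX).
(* Union bound over the index sets J: there are at most 2^n <= e^n of them, whence the 1 in the
   exponent. *)
apply: (@le_trans _ _ (\sum_(J : {set 'I_n} | (kappa * n%:R <= #|J|%:R)%R) expR (- (kappa * n%:R * l)))%:E).
  apply: measure_bigU_le => // J kJ.
  rewrite (indX _ (fun=> B)) ?map_inj_uniq ?enum_uniq//; last exact: val_inj.
  rewrite big_map.
  have bE : mu B = (fine (mu B))%:E by rewrite fineK// fin_num_measure.
  have -> : (\prod_(i <- enum J) P (X i @^-1` B) = (fine (mu B) ^+ #|J|)%:E)%E.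
    rewrite cardE; elim: (enum J) => [|i s IH]; first by rewrite big_nil expr0.
    by rewrite big_cons IH idX// bE -EFinM exprS.
  have muB' : fine (mu B) <= expR (- l) by rewrite -lee_fin -bE.
  have mu0 : 0 <= fine (mu B) by rewrite -lee_fin -bE.
  rewrite lee_fin; apply: (@le_trans _ _ (expR (- l) ^+ #|J|)).
    by apply: lerXn2r; rewrite ?nnegrE ?expR_ge0.
  rewrite -expRM_natl ler_expR mulrN lerN2.
  by rewrite ler_wpM2r.
set c := expR _; have c0 : 0 <= c by exact: expR_ge0.
rewrite lee_fin; apply: (@le_trans _ _ (\sum_(J : {set 'I_n}) c)).
  by rewrite [leRHS](bigID (fun J : {set 'I_n} => kappa * n%:R <= #|J|%:R))/= lerDl sumr_ge0.
have -> : \sum_(J : {set 'I_n}) c = 2 ^+ n * c.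
  by rewrite sumr_const -[LHS]mulr_natl -(natrX R 2 n) -cardsT -powersetT card_powerset cardsT card_ord.
have -> : n%:R * (1 - kappa * l) = n%:R * 1 + - (kappa * n%:R * l) by ring.
rewrite expRD ler_wpM2r// expRM_natl.
apply: lerXn2r; rewrite ?nnegrE ?ler0n ?expR_ge0//.
by have := @expR_ge1Dx R 1; lra.
Qed.

(** If f(0) = 1, [closure_XM] yields a neighbourhood free of transforms from [XB], so the
    probability is zero. The estimate by [tail_fraction] concerns f(0) < 1. *)
Lemma rate_off_XM f (a : R) : XMp1 f -> ~ XM R f ->
  exists2 k, (0 < k)%N & forall n, (0 < n)%N -> pr (Vk k f `&` XM R) n <= expR (n%:R * a).
Proof.
move=> [fX f01] nfM.
have [f1|fn1] := eqVneq (f 0) 1%E.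
  have [k [k0 kP]] : exists k, (0 < k)%N /\ ~ exists g, (Vk k f `&` XMp R `&` XB R) g.
    apply: contrapT => H; apply: nfM; apply: closure_XM => //; split => // k k0.
    by apply: contrapT => h; apply: H; exists k.
  exists k => // n n0; rewrite /pr (_ : [set w | _] = set0) ?measure0 ?expR_ge0//.
  rewrite -subset0 => w [wV wX]; apply: kP; exists (Mn X n w); split.
    by split => //; case: wX.
  by case: n n0 {wV wX} => // n _; exact: (em_XB (fun i => X i w)).
have f0 : (f 0%R < 1%:E)%E by rewrite lt_neqAle fn1.
have [r fr r0] := XMp_fin fX (lt_trans f0 (ltry _)).
move: f0; rewrite fr lte_fin => r1.
pose c := (1 + r) / 2; pose c' := (1 + c) / 2.
have rc : r < c by rewrite /c; lra.
have c0 : 0 < c by lra.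
have cc' : c < c' by rewrite /c' /c; lra.
have c'1 : c' < 1 by rewrite /c' /c; lra.
have c'0 : 0 < c' by lra.
pose kappa := 1 - c / c'.
have kE : kappa * c' = c' - c by rewrite /kappa mulrBl mul1r divfK// gt_eqF.
have kappa0 : 0 < kappa by rewrite subr_gt0 ltr_pdivrMr// mul1r.
(* Solves 1 - kappa l = -|a|, which is at most a. *)
pose l := (`|a| + 1) / kappa.
have l0 : 0 <= l by rewrite divr_ge0 ?(ltW kappa0)// addr_ge0.
have lE : kappa * l = `|a| + 1 by rewrite /l mulrC divfK// gt_eqF.
have [L L0 muL] : exists2 L : R, 0 < L & (mu (~` `[(- L)%R, L]%classic) <= (expR (- l))%:E)%E.
  have : ((1 - expR (- l))%:E < lap mu 0%R)%E.
    by rewrite -mgfE mgf0 lte_fin gtrBl expR_gt0.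
  move=> /lapT_gt[L L0]; rewrite lapT0 => h; exists L => //.
  have -> : (mu (~` `[(- L)%R, L]%classic) = 1 - mu `[(- L)%R, L]%classic)%E.
    exact: probability_setC.
  set b := fine (mu `[(- L)%R, L]%classic).
  have bE : mu `[(- L)%R, L]%classic = b%:E by rewrite /b fineK// fin_num_measure.
  have : ((1 - expR (- l))%:E < b%:E)%E by rewrite -bE.
  by rewrite bE lte_fin -EFinB lee_fin => h'; lra.
(* For |t| < delta and |x| <= L this gives exp(t x) >= exp(-delta L) = c'. *)
pose delta := - ln c' / L.
have lnc : ln c' < 0 by rewrite ln_lt0// c'0.
have delta0 : 0 < delta by rewrite divr_gt0// oppr_gt0.
have dL : delta * L = - ln c' by rewrite /delta divfK// gt_eqF.
have fc : (f 0%R < c%:E)%E by rewrite fr lte_fin.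
have [k k0 kV] := Vk_hit fX fc delta0.
exists k => // n n0.
have n0' : 0 < n%:R :> R by rewrite ltr0n.
have mV := measurable_event n (AWopen_Vk k0 fX).
rewrite -lee_fin -prE//.
have mB : measurable (~` `[(- L)%R, L]%classic) by apply: measurableC.
have := tail_fraction n mB l0 (ltW kappa0) muL.
set E := \big[setU/set0]_(J | _) _ => EP.
apply: (@le_trans _ _ (P E)).
  apply: le_measure; rewrite ?inE//.
    apply: bigsetU_measurable => J _; apply: fin_bigcap_measurable => // i _.
    exact: (measurable_preimX iidX).
  move=> w [wV wX]; have [wXp _] := wX.
  have [t] := kV _ wXp wV; rewrite subr0 => td tc.
  pose J : {set 'I_n} := [set i : 'I_n | X i w \notin `[- L, L]]%SET.
  have big i : i \notin J -> c' <= expR (t * X i w).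
    rewrite inE negbK in_itv /= -ler_norml => iL.
    rewrite -[leLHS]lnK ?posrE// ler_expR.
    have : - (t * X i w) <= delta * L.
      rewrite (le_trans (ler_norm _))// normrN normrM ler_pM// ltW//.
    rewrite dL; lra.
  have sumJ : c' * (n%:R - #|J|%:R) <= \sum_(i < n) expR (t * X i w).
    have -> : n%:R - #|J|%:R = #|~: J|%:R :> R.
      by apply/eqP; rewrite subr_eq -natrD addnC cardsC card_ord.
    rewrite (bigID (fun i => i \in J))/= -[leLHS]add0r lerD//.
      by apply: sumr_ge0 => i _; exact: expR_ge0.
    rewrite mulr_natr -sumr_const.
    rewrite (eq_bigl (fun i => i \notin J)); last by move=> i; rewrite !inE.
    by apply: ler_sum => i /big.
  have nc : \sum_(i < n) expR (t * X i w) < n%:R * c.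
    by move: tc; rewrite lte_fin mulrC ltr_pdivrMr// mulrC.
  have kJ : kappa * n%:R <= #|J|%:R.
    rewrite -(ler_pM2r c'0) mulrAC kE; lra.
  rewrite /E -bigcup_seq_cond; exists J => /=.
    by rewrite mem_index_enum.
  move=> i /= /mapP[j]; rewrite mem_enum inE => jL -> /=.
  by apply/negP; move: jL; rewrite in_itv.
apply: (le_trans EP); rewrite lee_fin ler_expR ler_wpM2l ?ler0n// lE.
by have := ler_norm (- a); rewrite normrN; lra.
Qed.

End Rates.

(** * The rate function and the large deviation bounds *)

Section LDP.
Variables (R : realType) (d : measure_display) (T : measurableType d).
Variables (P : probability T R) (mu : probability R R) (X : nat -> T -> R).
Hypothesis iidX : iid_seq P mu X.
Implicit Types (f g : efun R) (G F K : set (efun R)).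

Lemma IM_ge f G : AWopen (XM R) G -> G f -> (- limn_esup (lprob P X G) <= IM P X f)%E.
Proof. by move=> Go Gf; rewrite leeN2; apply: ereal_inf_lbound; exists G. Qed.

Lemma IM_gt f (a : R) : (a%:E < IM P X f)%E ->
  exists G, [/\ AWopen (XM R) G, G f & (limn_esup (lprob P X G) < (- a)%:E)%E].
Proof.
rewrite /IM lteNr -EFinN => /ereal_inf_lt[_ [G [Go Gf] <-] h]; by exists G.
Qed.

(** By superadditivity, the upper rate of a smaller neighbourhood of f is at most the lower rate of
    the given one, so the two infima coincide. *)
Lemma IM_liminfE f : XM R f -> IM P X f = IM_liminf P X f.
Proof.
move=> fXM; have [fX _] := fXM; congr (- _)%E; apply/eqP; rewrite eq_le; apply/andP; split.
  apply: le_ereal_inf_tmp => _ [G [Go Gf] <-].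
  have [k k0 kP] := lprob_superadditive iidX fXM Go Gf.
  apply: (@le_trans _ _ (limn_esup (lprob P X (Vk k f `&` XM R)))).
    apply: ereal_inf_lbound; exists (Vk k f `&` XM R) => //; split.
      exact: AWopen_Vk.
    by split=> //; exact: Vk_self.
  by apply: limn_esup_le; exists 1%N => // n /= n0; exact: kP.
apply: le_ereal_inf_tmp => _ [G [Go Gf] <-].
apply: (@le_trans _ _ (limn_einf (lprob P X G))); last exact: limn_einf_sup.
by apply: ereal_inf_lbound; exists G.
Qed.

Lemma AWopen_XM : AWopen (XM R) (XM R).
Proof. by split=> // f _; exists 1%N; split=> // g []. Qed.

Lemma IM_ge0 f : XM R f -> (0 <= IM P X f)%E.
Proof.
move=> fXM; apply: le_trans (IM_ge AWopen_XM fXM).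
rewrite leeNr oppe0; apply: limn_esup_le; exists 1%N => // n /= n0.
rewrite lprob_le// mulr0 expR0; apply: pr_le1.
exact: (measurable_event iidX) AWopen_XM.
Qed.

Definition IM_level (a : R) := [set f | XM R f /\ (IM P X f <= a%:E)%E].

(** An open set witnessing [IM P X f > a] witnesses the same inequality at each of its points. *)
Lemma IM_level_closed a : AWclosed (XM R) (IM_level a).
Proof.
split; first by move=> f [].
split; first by move=> f [].
move=> f [fXM nIf]; have : (a%:E < IM P X f)%E.
  by rewrite ltNge; apply/negP => h; exact: nIf.
move=> /IM_gt[G [Go Gf Ga]]; have [GX /(_ f Gf)[k [k0 kG]]] := Go.
exists k; split=> // g /kG Gg; split; first exact: GX.
move=> [_]; apply/negP; rewrite -ltNge (lt_le_trans _ (IM_ge Go Gg))//.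
by rewrite lteNr -EFinN.
Qed.

Lemma closed_nbhs F f : AWclosed (XM R) F -> XM R f -> ~ F f ->
  exists2 k, (0 < k)%N & Vk k f `&` XM R `<=` ~` F.
Proof.
by move=> [_ [_ /(_ f)]] FC fXM nF; have [|k [k0 kF]] := FC; [split|exists k => // g /kF[]].
Qed.

Lemma limn_esup_off_XM f (a : R) : XMp1 f -> ~ XM R f ->
  exists2 k, (0 < k)%N & (limn_esup (lprob P X (Vk k f `&` XM R)) <= a%:E)%E.
Proof.
move=> f1 nf; have [k k0 kP] := rate_off_XM iidX a f1 nf; exists k => //.
by apply: limn_esup_le; exists 1%N => // n /= n0; rewrite lprob_le// kP.
Qed.

(** The ideal consists of the sets whose trace on the level set is finitely covered. A point off the
    level set, inside or outside [XM], has a neighbourhood with empty trace. *)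
Lemma IM_level_compact a : AWcompact (XM R) (IM_level a).
Proof.
split; first by move=> f [].
move=> I U Uo KU; set K := IM_level a in KU *.
have [|A B|A B AB|f f1|J [fJ KJ]] :=
  @XMp1_ideal R (fun B => exists J : set I, finite_set J /\ B `&` K `<=` \bigcup_(i in J) U i).
- by exists set0; split=> //; rewrite set0I; exact: sub0set.
- move=> [J [fJ AJ]] [J' [fJ' BJ]]; exists (J `|` J'); split; first by rewrite finite_setU.
  by move=> f [[Af|Bf] Kf]; [have [i Ji Uif] := AJ f (conj Af Kf)|
    have [i Ji Uif] := BJ f (conj Bf Kf)]; exists i => //; [left|right].
- by move=> [J [fJ BJ]]; exists J; split=> // f [/AB Bf Kf]; exact: BJ.
- have empty k : (0 < k)%N -> (forall g, Vk k f g -> XM R g -> ~ K g) ->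
      exists2 k, (0 < k)%N & exists J : set I,
        finite_set J /\ Vk k f `&` XMp R `&` K `<=` \bigcup_(i in J) U i.
    move=> k0 kP; exists k => //; exists set0; split=> // g [[gV _] Kg].
    by exfalso; apply: (kP g) => //; case: Kg.
  have [fXM|nfXM] := pselect (XM R f).
    have [Kf|nKf] := pselect (K f).
      have [i _ Uif] := KU f Kf; have [_ /(_ f Uif)[k [k0 kU]]] := Uo i.
      exists k => //; exists [set i]; split=> // g [[gV _] [gM _]].
      by exists i => //; exact: kU.
    have [k k0 kK] := closed_nbhs (IM_level_closed a) fXM nKf.
    by apply: (empty k) => // g gV gM; apply: kK.
  (* An upper rate of at most -(a + 1) on the neighbourhood forces [IM] to be at least a + 1 at its
     points in [XM]. *)
  have [k k0 kP] := limn_esup_off_XM (- (a + 1)) f1 nfXM.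
  apply: (empty k) => // g gV gM [_]; apply/negP; rewrite -ltNge.
  have [fX _] := f1.
  apply: lt_le_trans (IM_ge (AWopen_Vk k0 fX) (conj gV gM)).
  by rewrite lteNr -EFinN (le_lt_trans kP)// lte_fin; lra.
- by exists J; split=> // f Kf; apply: KJ; split=> //; apply: XM_XMp1; case: Kf.
Qed.

Lemma IM_lower G : AWopen (XM R) G ->
  (- ereal_inf (IM P X @` G) <= limn_einf (lprob P X G))%E.
Proof.
move=> Go; rewrite leeNl; apply: le_ereal_inf_tmp => _ [f Gf <-].
have [GX _] := Go; rewrite IM_liminfE; last exact: GX.
by rewrite leeN2; apply: ereal_inf_lbound; exists G.
Qed.

Lemma measurable_closed_event F n : (0 < n)%N -> AWclosed (XM R) F ->
  measurable [set w | F (Mn X n w)].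
Proof.
move=> n0 [_ Fo]; have -> : [set w | F (Mn X n w)] = ~` [set w | (XM R `\` F) (Mn X n w)].
  apply/seteqP; split=> w /=; first by move=> Fw [].
  by move=> h; apply: contrapT => nF; apply: h; split=> //; exact: Mn_XM.
by apply: measurableC; exact: (measurable_event iidX).
Qed.

Lemma pr_setU A B n : measurable [set w | A (Mn X n w)] -> measurable [set w | B (Mn X n w)] ->
  pr P X (A `|` B) n <= pr P X A n + pr P X B n.
Proof.
move=> mA mB; have mU : measurable [set w | (A `|` B) (Mn X n w)] by exact: measurableU.
by rewrite -lee_fin EFinD -!prE//; exact: measureU2.
Qed.

(** Shaped to form an ideal: the measurable cover [B'] makes it hereditary for arbitrary subsets,
    and the factor m absorbs finite unions without affecting the rate. *)
Definition exp_small (a : R) (B : set (efun R)) := exists B' (m n0 : nat),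
  [/\ B `<=` B', forall n, (0 < n)%N -> measurable [set w | B' (Mn X n w)] &
      forall n, (n0 < n)%N -> pr P X B' n <= m%:R * expR (n%:R * a)].

Lemma exp_small_open a G B : AWopen (XM R) G -> B `<=` G ->
  (limn_esup (lprob P X G) < a%:E)%E -> exp_small a B.
Proof.
move=> Go BG /limn_esup_lt[N _ h]; exists G, 1%N, N; split=> //.
  by move=> n _; exact: (measurable_event iidX).
move=> n Nn; rewrite mul1r -lprob_le; last exact: leq_ltn_trans Nn.
by apply: ltW; apply: h => /=; exact: ltnW.
Qed.

Lemma exp_small_limn F a : AWclosed (XM R) F -> exp_small a F ->
  (limn_esup (lprob P X F) <= a%:E)%E.
Proof.
move=> Fc [B [m [n0 [FB mB Bm]]]]; apply/lee_addgt0Pr => e e0.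
rewrite -EFinD; apply: limn_esup_le; pose M := m%:R / e.
exists (maxn n0.+1 (Num.truncn M).+1) => // n /=; rewrite geq_max => /andP[n0n Mn'].
have n_gt0 : (0 < n)%N by exact: leq_trans n0n.
rewrite lprob_le//; apply: (@le_trans _ _ (m%:R * expR (n%:R * a))).
  apply: le_trans (Bm n n0n); apply: pr_le => //; first exact: measurable_closed_event.
    exact: mB.
  by move=> w /FB.
rewrite mulrDr expRD mulrC ler_wpM2l ?expR_ge0//.
(* The factor m is absorbed by exp(n e) >= n e >= m. *)
have mne : m%:R <= n%:R * e.
  by rewrite -ler_pdivrMr// (le_trans (ltW (truncnS_gt _)))// ler_nat.
by rewrite (le_trans mne)// (le_trans _ (expR_ge1Dx _))// lerDr.
Qed.

Lemma lee_EFin_gt (u v : \bar R) :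
  (forall a : R, (v < a%:E)%E -> (u <= a%:E)%E) -> (u <= v)%E.
Proof.
case: v => [r| |] h; last 1 first.
- case: u h => [s| |] h //; last by have := h 0%R (ltNyr _).
  have /h : (-oo < (s - 1)%:E)%E by exact: ltNyr.
  by rewrite lee_fin lerBrDr gerDl ler10.
- by apply/lee_addgt0Pr => e e0; rewrite -EFinD; apply: h; rewrite lte_fin ltrDl.
- exact: leey.
Qed.

(** For a above the bound, the sets with exponentially small trace on [F] form an ideal containing a
    neighbourhood of every point of [XMp1]: a point of [F] has [IM] above -a, a point of [XM] off
    [F] has a neighbourhood with empty trace, and a point outside [XM] is settled by
    [limn_esup_off_XM]. *)
Lemma IM_upper F : AWclosed (XM R) F ->
  (limn_esup (lprob P X F) <= - ereal_inf (IM P X @` F))%E.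
Proof.
move=> Fc; have [FX _] := Fc.
apply: lee_EFin_gt => a; rewrite lteNl -EFinN => ha.
apply: exp_small_limn => //.
have sub B C : B `<=` C -> exp_small a C -> exp_small a B.
  move=> BC [C' [m [n0 [CC' mC hC]]]]; exists C', m, n0; split=> //.
  exact: subset_trans CC'.
suff : exp_small a (XMp1 (R:=R) `&` F) by apply: sub => f Ff; split=> //; exact: XM_XMp1 (FX _ Ff).
have small0 : exp_small a set0.
  exists set0, 0%N, 0%N; split=> // n _; last by rewrite /pr measure0 mul0r.
  exact: measurable0.
apply: (@XMp1_ideal R (fun B => exp_small a (B `&` F))).
- by rewrite set0I.
- move=> A B [A' [m [n0 [AA mA hA]]]] [B' [m' [n0' [BB mB hB]]]].
  exists (A' `|` B'), (m + m')%N, (maxn n0 n0'); split.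
  + by move=> f [[Af|Bf] Ff]; [left; exact: AA|right; exact: BB].
  + by move=> n n1; exact: measurableU (mA n n1) (mB n n1).
  + move=> n; rewrite gtn_max => /andP[h1 h2]; have n1 : (0 < n)%N by exact: leq_ltn_trans h1.
    rewrite natrD mulrDl (le_trans (pr_setU (mA n n1) (mB n n1)))//.
    by rewrite lerD// ?hA ?hB.
- by move=> A B AB; apply: sub => f [/AB].
- move=> f f1; have [fX _] := f1.
  have [fXM|nfXM] := pselect (XM R f); last first.
    have [k k0 kP] := limn_esup_off_XM (a - 1) f1 nfXM; exists k => //.
    apply: (exp_small_open (AWopen_Vk k0 fX)); first by move=> g [[gV _] /FX].
    by rewrite (le_lt_trans kP)// lte_fin; lra.
  have [Ff|nFf] := pselect (F f).
    have : ((- a)%:E < IM P X f)%E.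
      by apply: lt_le_trans ha _; apply: ereal_inf_lbound; exists f.
    move=> /IM_gt[G [Go Gf]]; rewrite opprK => Ga.
    have [_ /(_ f Gf)[k [k0 kG]]] := Go; exists k => //.
    by apply: (exp_small_open Go) Ga => g [[gV _] /FX gM]; exact: kG.
  have [k k0 kF] := closed_nbhs Fc fXM nFf; exists k => //.
  by apply: sub small0 => g [[gV _] Fg]; apply: (kF g) => //; split=> //; exact: FX.
Qed.

End LDP.

Theorem mainTheorem9 (R : realType) (d : measure_display) (T : measurableType d)
  (P : probability T R) (mu : probability R R) (X : nat -> T -> R) :
  iid_seq P mu X ->
  XM R = AWclosure (XB R) `&` [set f | f 0 = 1%E] /\
  (forall n G, AWopen (XM R) G -> measurable [set w | G (Mn X n w)]) /\
  (forall f, XM R f -> IM P X f = IM_liminf P X f) /\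
  good_rate (IM P X) /\
  LDP P X (IM P X).
Proof.
move=> iidX; split.
  apply/seteqP; split=> f; first by move=> fM; split; [exact: XM_sub_closure|exact: XM0].
  by move=> [fB f0]; exact: closure_XM.
split; first by move=> n G; exact: (measurable_event iidX).
split; first by move=> f; exact: (IM_liminfE iidX).
split; last by split; [exact: (IM_lower iidX)|exact: (IM_upper iidX)].
split; first by move=> f; exact: (IM_ge0 iidX).
split=> a; first exact: IM_level_closed.
exact: (IM_level_compact iidX).
Qed.
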